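(* Let $M$ be a closed connected smooth manifold. Then the following two statements hold. (1) Given a Riemannian metric $g$ on $M$ and a null-homologous, coorientable, simple periodic geodesic $\gamma$ of $(M,g)$, one can construct an exact magnetic field $\mathrm d\alpha$ (with $\alpha$ a one-form on $M$) such that $\gamma$ is a magnetic geodesic of strong geodesic type of $(M,g,\mathrm d\alpha)$. (2) Given a null-homologous, coorientable, smooth embedded loop $\gamma$ in $M$ and a one-form $\alpha$ on $M$ such that $\dot\gamma(t)\in\ker(\mathrm d\alpha_{\gamma(t)})$ for all $t$ and $\alpha_{\gamma(t)}(\dot\gamma(t))$ is constant (independent of $t$), one can construct a Riemannian metric $g$ on $M$ such that $\gamma$ is a magnetic geodesic of strong geodesic type of $(M,g,\mathrm d\alpha)$. In particular, in both cases the magnetic system $(M,g,\mathrm d\alpha)$ is of strong geodesic type.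
   Context: A smooth embedded loop is a smooth embedding $\gamma:\mathbb R/T\mathbb Z\to M$, $T>0$ (a simple periodic geodesic is a geodesic that is such an embedded loop). It is coorientable if $\gamma^*TM$ is an orientable bundle over the circle, and null-homologous if its class in $H_1(M)$ vanishes. $\ker\mathrm d\alpha_p=\{v\in T_pM:\mathrm d\alpha_p(v,w)=0\ \forall w\in T_pM\}$. For a Riemannian metric $g$ and a one-form $\alpha$ on the closed connected manifold $M$, the triple $(M,g,\mathrm d\alpha)$ is called an exact magnetic system with magnetic field $\mathrm d\alpha$. A smooth embedded loop $\gamma$ is a magnetic geodesic of strong geodesic type of $(M,g,\mathrm d\alpha)$ if: $\gamma$ is coorientable and null-homologous; $\gamma$ is a geodesic of $(M,g)$; $\dot\gamma(t)\in\ker\mathrm d\alpha_{\gamma(t)}$ for all $t$; $|\alpha_{\gamma(t)}|_g=\max_{x\in M}|\alpha_x|_g$ for all $t$; and $g_{\gamma(t)}(\dot\gamma(t),v)=\alpha_{\gamma(t)}(v)$ for all $t$ and all $v\in T_{\gamma(t)}M$. The exact magnetic system $(M,g,\mathrm d\alpha)$ is of strong geodesic type if it admits such a loop.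
   Formalization: In (2) the constant value of α(γ̇) is required to be positive: the conclusion forces α(γ̇)=g(γ̇,γ̇)>0, so the claim fails for constants ≤ 0 (e.g. α=0 on the sphere with any embedded loop). *)

(* Defs.v *)
(* MathComp-Analysis. *)
From HB Require Import structures.
From mathcomp Require Import all_boot all_order all_algebra.
From mathcomp Require Import all_classical all_reals all_analysis.
Set Implicit Arguments.
Unset Strict Implicit.
Unset Printing Implicit Defensive.
Import Order.TTheory GRing.Theory Num.Theory.
Import numFieldNormedType.Exports.
Local Open Scope classical_set_scope.
Local Open Scope ring_scope.

(* Meant for finite-dimensional V and U open: existence and continuity on U of
   all iterated directional derivatives up to order k is then the usual C^k. *)
Fixpoint C_k (R : realType) (V W : normedModType R) (k : nat) (U : set V)
    (f : V -> W) : Prop :=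
  (forall x, U x -> {for x, continuous f}) /\
  match k with
  | 0 => True
  | k'.+1 => forall v, (forall x, U x -> derivable f x v) /\ C_k k' U ('D_v f)
  end.

Definition smooth (R : realType) (V W : normedModType R) (U : set V)
    (f : V -> W) : Prop := forall k, C_k k U f.

Definition unit_row (R : realType) (n : nat) (k : 'I_n) : 'rV[R]_n :=
  delta_mx 0 k.

(* [coords] and [param] are total functions whose values matter only on [source]
   and [target], where they are inverse homeomorphisms. *)
Record chart (R : realType) (n : nat) (X : topologicalType) := Chart {
  source : set X;
  target : set 'rV[R]_n;
  coords :> X -> 'rV[R]_n;
  param : 'rV[R]_n -> X;
  open_source : open source;
  open_target : open target;
  coords_target : forall p, source p -> target (coords p);
  param_source : forall x, target x -> source (param x);
  coordsK : forall p, source p -> param (coords p) = p;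
  paramK : forall x, target x -> coords (param x) = x;
  coords_continuous : forall p, source p -> {for p, continuous coords};
  param_continuous : forall x, target x -> {for x, continuous param}
}.

(* The atlas need not be maximal.  [chart_at] selects, at every point p, one
   chart of the atlas around p; it fixes the identification of T_pM with R^n
   used below and carries no further structure. *)
Record smoothManifold (R : realType) (n : nat) := SmoothManifold {
  space :> topologicalType;
  hausdorffM : hausdorff_space space;
  second_countableM : @second_countable space;
  atlas : set (chart R n space);
  chart_at : space -> chart R n space;
  chart_at_atlas : forall p, atlas (chart_at p);
  chart_at_source : forall p, source (chart_at p) p;
  smooth_transition : forall e f, atlas e -> atlas f ->
    smooth (target e `&` param e @^-1` source f) (f \o param e)
}.

Arguments atlas {R n} s _.

Section Tensors.
Context (R : realType) (n : nat) (M : smoothManifold R n).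

(* T_pM is 'rV[R]_n: the row v stands for the tangent vector at p whose
   components in the chart [chart_at p] are the entries of v. *)
Definition tangent (p : M) : Type := 'rV[R]_n.

(* The tangent vector at p whose components in the chart e are w. *)
Definition coord_vector (e : chart R n M) (p : M) (w : 'rV[R]_n) : tangent p :=
  'D_w (chart_at p \o param e) (e p).

Definition local_form (a : forall p : M, tangent p -> R) (e : chart R n M)
    (x w : 'rV[R]_n) : R :=
  a (param e x) (coord_vector e (param e x) w).

Definition local_metric (g : forall p : M, tangent p -> tangent p -> R)
    (e : chart R n M) (x v w : 'rV[R]_n) : R :=
  g (param e x) (coord_vector e (param e x) v)
                (coord_vector e (param e x) w).

Record one_form := OneForm {
  form_val :> forall p : M, tangent p -> R;
  form_linear : forall p (c : R) (v w : 'rV[R]_n),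
    @form_val p (c *: v + w) = c * @form_val p v + @form_val p w;
  form_smooth : forall e, atlas M e -> forall w,
    smooth (target e) (fun x => local_form (@form_val) e x w)
}.

Record riemannian_metric := RiemannianMetric {
  metric_val :> forall p : M, tangent p -> tangent p -> R;
  metric_linear : forall p (c : R) (u v w : 'rV[R]_n),
    @metric_val p (c *: u + v) w = c * @metric_val p u w + @metric_val p v w;
  metric_sym : forall p (v w : 'rV[R]_n), @metric_val p v w = @metric_val p w v;
  metric_pos : forall p (v : 'rV[R]_n), v != 0 -> 0 < @metric_val p v v;
  metric_smooth : forall e, atlas M e -> forall v w,
    smooth (target e) (fun x => local_metric (@metric_val) e x v w)
}.

(* dα(V, W) = V α(W) - W α(V) for V, W constant in the chart [chart_at p]. *)
Definition dform (a : one_form) (p : M) (v w : tangent p) : R :=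
  'D_v (fun x => local_form a (chart_at p) x w) (chart_at p p)
  - 'D_w (fun x => local_form a (chart_at p) x v) (chart_at p p).

Definition ker_dform (a : one_form) (p : M) : set (tangent p) :=
  [set v | forall w, dform a v w = 0].

Definition conorm (g : riemannian_metric) (a : one_form) (p : M) : R :=
  sup [set `|a p v| | v in [set v : tangent p | g p v v <= 1]].

Definition gram (g : riemannian_metric) (e : chart R n M) (x : 'rV[R]_n) :
    'M[R]_n :=
  \matrix_(a, b) local_metric g e x (unit_row R a) (unit_row R b).

(* Γ^k_ab of the Levi-Civita connection in the chart e. *)
Definition christoffel (g : riemannian_metric) (e : chart R n M)
    (k a b : 'I_n) (x : 'rV[R]_n) : R :=
  2^-1 * \sum_(l < n) invmx (gram g e x) k l *
    ('D_(unit_row R a) (fun y => gram g e y b l) x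
     + 'D_(unit_row R b) (fun y => gram g e y a l) x
     - 'D_(unit_row R l) (fun y => gram g e y a b) x).

End Tensors.

Section Loops.
Context (R : realType) (n : nat) (M : smoothManifold R n).

Definition velocity (gamma : R -> M) (t : R) : tangent (gamma t) :=
  derive1 (chart_at (gamma t) \o gamma) t.

Definition smooth_curve (gamma : R -> M) : Prop :=
  continuous gamma /\
  forall e, atlas M e -> smooth (gamma @^-1` source e) (e \o gamma).

(* Loops R/TZ -> M are T-periodic maps R -> M.  The last two clauses say that
   the induced map on R/TZ is injective with continuous inverse on its image. *)
Definition embedded_loop (T : R) (gamma : R -> M) : Prop :=
  [/\ 0 < T /\ forall t, gamma (t + T) = gamma t,
      smooth_curve gamma,
      forall t, velocity gamma t != 0,
      forall s t, gamma s = gamma t -> exists k : int, s - t = k%:~R * T &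
      forall (t eps : R), 0 < eps ->
        \forall p \near gamma t, forall s, gamma s = p ->
          exists k : int, `|s - t - k%:~R * T| < eps].

Definition geodesic (g : riemannian_metric M) (gamma : R -> M) : Prop :=
  smooth_curve gamma /\
  forall e, atlas M e -> forall t, source e (gamma t) -> forall k : 'I_n,
    let x := e \o gamma in let dx := derive1 x in
    derive1 dx t 0 k
    + \sum_(a < n) \sum_(b < n)
        christoffel g e k a b (x t) * dx t 0 a * dx t 0 b = 0.

(* An orientation of T_pM = R^n is coded by a boolean, [false] being the one
   for which the standard basis is positive. *)
Definition positive_frame (o : bool) (F : 'M[R]_n) : bool :=
  0 < (-1) ^+ o * \det F.

Definition coord_frame (e : chart R n M) (p : M) : 'M[R]_n :=
  \matrix_(k < n) (coord_vector e p (unit_row R k) : 'rV[R]_n).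

(* γ^*TM is orientable: orientations o t of T_{γ(t)}M, depending only on t
   modulo T, that are locally constant in the trivialisations of γ^*TM given
   by the coordinate frames of charts. *)
Definition coorientable (T : R) (gamma : R -> M) : Prop :=
  exists o : R -> bool,
    (forall t, o (t + T) = o t) /\
    forall e, atlas M e -> forall t, source e (gamma t) ->
      \forall s \near t,
        positive_frame (o s) (coord_frame e (gamma s))
        = positive_frame (o t) (coord_frame e (gamma t)).

(* Singular simplices are maps R -> M and R * R -> M considered on the segment
   [0, 1] and on the triangle with vertices (0,0), (1,0), (0,1). *)
Definition triangle : set (R * R) :=
  [set x | [/\ 0 <= x.1, 0 <= x.2 & x.1 + x.2 <= 1]].

(* Coefficient of the 1-simplex tau in the chain consisting of the single
   1-simplex sigma. *)
Definition simplex_coef (sigma tau : R -> M) : int :=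
  (`[< forall s : R, 0 <= s <= 1 -> sigma s = tau s >] : nat)%:R.

Definition boundary_coef (sigma : R * R -> M) (tau : R -> M) : int :=
  simplex_coef (fun s => sigma (1 - s, s)) tau
  - simplex_coef (fun s => sigma (0, s)) tau
  + simplex_coef (fun s => sigma (s, 0)) tau.

(* The 1-cycle s |-> γ(sT) is the boundary of an integral singular 2-chain. *)
Definition null_homologous (T : R) (gamma : R -> M) : Prop :=
  exists (m : nat) (c : 'I_m -> int) (sigma : 'I_m -> R * R -> M),
    (forall i, {within triangle, continuous (sigma i)}) /\
    forall tau : R -> M,
      \sum_(i < m) c i * boundary_coef (sigma i) tau
      = simplex_coef (fun s => gamma (s * T)) tau.

Definition strong_magnetic_geodesic (g : riemannian_metric M)
    (a : one_form M) (T : R) (gamma : R -> M) : Prop :=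
  [/\ embedded_loop T gamma,
      coorientable T gamma /\ null_homologous T gamma,
      geodesic g gamma,
      forall t, ker_dform a (velocity gamma t) &
      (forall t (x : M), conorm g a x <= conorm g a (gamma t)) /\
      (forall t (v : tangent (gamma t)),
         g (gamma t) (velocity gamma t) v = a (gamma t) v)].

Definition strong_geodesic_type (g : riemannian_metric M) (a : one_form M) :
    Prop :=
  exists (T : R) (gamma : R -> M), strong_magnetic_geodesic g a T gamma.

End Loops.

(* Main.v *)
Require Import Defs.
From HB Require Import structures.
From mathcomp Require Import all_boot all_order all_algebra.
From mathcomp Require Import all_classical all_reals all_analysis.
From mathcomp Require Import ring lra.
Set Implicit Arguments.
Unset Strict Implicit.
Unset Printing Implicit Defensive.
Import Order.TTheory GRing.Theory Num.Theory.
Import numFieldNormedType.Exports.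
Local Open Scope classical_set_scope.
Local Open Scope ring_scope.

(* Let X be the velocity field of the loop and suppose that the one-form α
   satisfies α = g(X, .) along it and α(v)^2 <= C g(v, v) everywhere, with
   C = g(X, X).  With X frozen in a chart, C g(X, X) - α(X)^2 is minimal along
   the loop, so 1/2 D_w g(X, X) = D_w α(X).  By the Euler-Lagrange form
   d/dt g(X, w) = 1/2 D_w g(X, X) of the geodesic equation and
   d/dt g(X, w) = D_X α(w), the loop is a geodesic if and only if X lies in
   the kernel of dα.  It remains to produce such pairs.  Extend the velocity
   to a vector field X on M.  Given g, take α = 2C / (C + g(X, X)) g(X, .).
   Given α, take any metric h, put A = α(X), P v = A v - α(v) X and
   g(v, w) = h(P v, P w) + α(v) α(w) / c + (c - A)^2 h(v, w). *)

(** * Calculus of C^k functions *)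

(** The extension X is arbitrary off the loop and may vanish there. So the bound α(v)^2 <= C g(v, v)
    has to come out of the formulas at every point, and α = g(X, .) is recovered only where g(X, X)
    = C, respectively α(X) = c. In the first formula the factor 2C / (C + g(X, X)) equals 1 exactly
    where g(X, X) = C. In the second, P X = 0 removes the first term from g(X, .), the last term
    vanishes where A = c, and the middle one leaves A α(v) / c = α(v). The middle term alone yields
    the bound; the last keeps g definite where A differs from c. The same bound makes |α| maximal
    along the loop: its supremum over unit vectors is at most sqrt C everywhere, and X / sqrt C
    attains it on the loop. Extending the velocity relies on the embedding: near a loop point only
    one strand of the loop may be seen. As smoothness is phrased through iterated directional
    derivatives, the chain rule, the linearity of D_v in v and the symmetry of second derivatives
    are all derived from the mean value theorem. *)

Lemma near_open (T : topologicalType) (U : set T) (P : T -> Prop) x :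
  open U -> U x -> (forall y, U y -> P y) -> \forall y \near x, P y.
Proof. by move=> oU Ux UP; apply: filterS UP _; exact: open_nbhs_nbhs. Qed.

Lemma near_continuous (T S : topologicalType) (f g : T -> S) x :
  (\forall y \near x, f y = g y) -> {for x, continuous f} ->
  {for x, continuous g}.
Proof.
move=> fg; rewrite /prop_for /continuous_at -(nbhs_singleton fg) => cf.
by apply: cvg_trans cf; apply: near_eq_cvg.
Qed.

Lemma cvg_row (R : realType) (T : Type) (F : set_system T) (FF : ProperFilter F)
    n (f : T -> 'rV[R]_n) (l : 'rV[R]_n) :
  (forall j, f x 0 j @[x --> F] --> l 0 j) -> f x @[x --> F] --> l.
Proof.
move=> fl; apply/cvgrPdist_le => e e0; near=> x.
rewrite /Num.Def.normr/= mx_normrE (bigmax_le _ (ltW e0))//= => -[i j] _.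
rewrite !mxE/= ord1; move: j; near: x; apply: filter_forall => j.
exact: ((cvgrPdist_le _ _).1 (fl j)).
Unshelve. all: by end_near. Qed.

Section CkBasics.
Context (R : realType) (V : normedModType R).
Implicit Types (U : set V) (k : nat).

Lemma C_k_ext (W : normedModType R) k U (f g : V -> W) :
  open U -> (forall x, U x -> f x = g x) -> C_k k U f -> C_k k U g.
Proof.
move=> oU; elim: k f g => [|k IH] f g fg /= [cf Df].
all: have cg x : U x -> {for x, continuous g}
  by move=> Ux; apply: near_continuous (cf x Ux); exact: near_open fg.
  by split.
split=> // v; have [dfv Cfv] := Df v; split.
  by move=> x Ux; apply: near_eq_derivable (dfv x Ux); exact: near_open fg.
by apply: IH Cfv => x Ux; apply: near_eq_derive; exact: near_open fg.
Qed.

Lemma C_k_sub (W : normedModType R) k U U' (f : V -> W) :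
  U' `<=` U -> C_k k U f -> C_k k U' f.
Proof.
move=> sU; elim: k f => [|k IH] f /= [cf Df]; split=> //; try by move=> x /sU /cf.
by move=> v; have [dv Cv] := Df v; split; [move=> x /sU /dv|exact: IH].
Qed.

(** Continuity and derivatives refer to the ambient space and not to the set, so [C_k] is a
    condition point by point and glues over arbitrary pieces. This is what makes extensions by zero
    smooth. *)
Lemma C_kU (W : normedModType R) k U U' (f : V -> W) :
  C_k k U f -> C_k k U' f -> C_k k (U `|` U') f.
Proof.
elim: k f => [|k IH] f /= [cf Df] [cf' Df']; split=> //;
  try by move=> x [/cf|/cf'].
move=> v; have [dv Cv] := Df v; have [dv' Cv'] := Df' v.
by split; [move=> x [/dv|/dv']|exact: IH].
Qed.

Lemma C_kW (W : normedModType R) k U (f : V -> W) :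
  C_k k.+1 U f -> C_k k U f.
Proof.
elim: k f => [|k IH] f /= [cf Df]; split=> // v.
by have [dv Cv] := Df v; split=> //; exact: IH.
Qed.

Lemma C_k_cst (W : normedModType R) k U (a : W) : C_k k U (fun=> a).
Proof.
elim: k a => [|k IH] a; split=> //; try by move=> x _; exact: cst_continuous.
move=> v; split; first by move=> x _; exact: derivable_cst.
rewrite (_ : 'D_v _ = fun=> 0); first exact: IH.
by apply/funext => x; exact: derive_cst.
Qed.

Lemma C_kD k U (f g : V -> R) : open U ->
  C_k k U f -> C_k k U g -> C_k k U (fun x => f x + g x).
Proof.
move=> oU; elim: k f g => [|k IH] f g /= [cf Df] [cg Dg]; split=> //;
  try by move=> x Ux; apply: cvgD; [exact: cf|exact: cg].
move=> v; have [df Cf] := Df v; have [dg Cg] := Dg v.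
split; first by move=> x Ux; apply: derivableD; [exact: df|exact: dg].
apply: C_k_ext (IH _ _ Cf Cg) => // x Ux.
by rewrite (deriveD (df x Ux) (dg x Ux)).
Qed.

Lemma C_kM k U (f g : V -> R) : open U ->
  C_k k U f -> C_k k U g -> C_k k U (fun x => f x * g x).
Proof.
move=> oU; elim: k f g => [|k IH] f g; first move=> /= [cf Df] [cg Dg]; last first.
  move=> Cf Cg; have [/= cf Df] := Cf; have [/= cg Dg] := Cg; split=> /=.
    by move=> x Ux; apply: cvgM; [exact: cf|exact: cg].
  move=> v; have [df Cdf] := Df v; have [dg Cdg] := Dg v.
  split; first by move=> x Ux; apply: derivableM; [exact: df|exact: dg].
  apply: C_k_ext (C_kD oU (IH _ _ (C_kW Cf) Cdg) (IH _ _ (C_kW Cg) Cdf)) => // x Ux.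
  by rewrite (deriveM (df x Ux) (dg x Ux)).
by split=> // x Ux; apply: cvgM; [exact: cf|exact: cg].
Qed.

Lemma C_kV k U (f : V -> R) : open U -> (forall x, U x -> f x != 0) ->
  C_k k U f -> C_k k U (fun x => (f x)^-1).
Proof.
move=> oU f0; elim: k => [|k IH] Cf; have [/= cf Df] := Cf.
  by split=> // x Ux; apply: cvgV; [exact: f0|exact: cf].
split=> [x Ux|v]; first by apply: cvgV; [exact: f0|exact: cf].
have [df Cdf] := Df v.
split=> [x Ux|]; first by apply: derivableV; [exact: f0|exact: df].
have Cfi := IH (C_kW Cf).
have := C_kM oU (C_k_cst k U (-1 : R)) (C_kM oU Cfi (C_kM oU Cfi Cdf)).
apply: C_k_ext => // x Ux.
rewrite (deriveV (f0 _ Ux) (df x Ux)) /= mulN1r scaleNr.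
by rewrite /GRing.scale /= expr2 invfM mulrA.
Qed.

Lemma C_k_sum (I : Type) (r : seq I) (P : pred I) k U (f : I -> V -> R) : open U ->
  (forall i, P i -> C_k k U (f i)) -> C_k k U (fun x => \sum_(i <- r | P i) f i x).
Proof.
move=> oU Cf; elim: r => [|i r IH].
  rewrite (_ : (fun x => _) = fun=> 0); first exact: C_k_cst.
  by apply/funext => x; rewrite big_nil.
have [Pi|nPi] := boolP (P i).
  rewrite (_ : (fun x => _) = fun x => f i x + \sum_(j <- r | P j) f j x).
    by apply: C_kD => //; exact: Cf.
  by apply/funext => x; rewrite big_cons Pi.
rewrite (_ : (fun x => _) = fun x => \sum_(j <- r | P j) f j x) //.
by apply/funext => x; rewrite big_cons (negbTE nPi).
Qed.

Lemma C_k_coord n k U (f : V -> 'rV[R]_n) j : open U ->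
  C_k k U f -> C_k k U (fun x => f x 0 j).
Proof.
move=> oU; elim: k f => [|k IH] f /= [cf Df].
all: have cj x : U x -> {for x, continuous (fun y => f y 0 j)}
  by move=> Ux; exact: (continuous_comp (cf x Ux) (@coord_continuous _ _ _ _ _ _)).
  by split.
split=> // v; have [df Cf] := Df v; split=> [x Ux|].
  by have /derivable_mxP := df x Ux; exact.
apply: C_k_ext (IH _ Cf) => // x Ux.
by rewrite (derive_mx (df x Ux)) mxE.
Qed.

Lemma C_k_row n k U (f : V -> 'rV[R]_n) : open U ->
  (forall j, C_k k U (fun x => f x 0 j)) -> C_k k U f.
Proof.
move=> oU; elim: k f => [|k IH] f Cf.
all: have cf x : U x -> {for x, continuous f}
  by move=> Ux; apply: cvg_row => j; have [/(_ x Ux)] := Cf j.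
  by split.
have df v x : U x -> derivable f x v.
  move=> Ux; apply/derivable_mxP => i j; rewrite ord1.
  by have [_ /(_ v) [/(_ x Ux)]] := Cf j.
split=> // v; split=> [x|]; first exact: df.
apply: IH => j; have [_ /(_ v) [_]] := Cf j; apply: C_k_ext => // x Ux.
by rewrite (derive_mx (df v x Ux)) mxE.
Qed.

End CkBasics.

(** * Mean values and the chain rule *)

Section ChainRule.
Context (R : realType).

Lemma is_derive_line (V W : normedModType R) (f : V -> W) (x v : V) (s : R) :
  derivable f (x + s *: v) v ->
  is_derive s 1 (fun r => f (x + r *: v)) ('D_v f (x + s *: v)).
Proof.
have eqg : (fun h => h^-1 *: (f (x + (h *: 1 + s) *: v) - f (x + s *: v))) =
           (fun h => h^-1 *: (f (h *: v + (x + s *: v)) - f (x + s *: v))).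
  by apply/funext => h; rewrite [h *: 1]mulr1 scalerDl addrCA.
by move=> df; split; [rewrite /derivable|rewrite /derive] => /=; rewrite eqg.
Qed.

(** The range of [s] is symmetric so that one statement covers both signs of [h]. *)
Lemma MVT_line (V : normedModType R) (f : V -> R) (x v : V) (h : R) :
  (forall s, `|s| <= `|h| -> derivable f (x + s *: v) v) ->
  exists2 s, `|s| <= `|h| & f (x + h *: v) - f x = h * 'D_v f (x + s *: v).
Proof.
move=> df.
have cont (a b : R) : (forall s, s \in `[a, b] -> `|s| <= `|h|) ->
    {within `[a, b], continuous (fun r => f (x + r *: v))}.
  move=> abh; apply: derivable_within_continuous => s sab.
  by have [] := is_derive_line (df s (abh _ sab)).
have [h0|/ltW h0] := leP 0 h.
- have bnd s : s \in `[0, h] -> `|s| <= `|h|.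
    by rewrite in_itv /= => /andP[s0 sh]; rewrite !ger0_norm.
  have [||c c0h] := @MVT_segment R (fun r => f (x + r *: v)) (fun s => 'D_v f (x + s *: v)) _ _ h0.
  + by move=> s s0h; apply: is_derive_line; apply/df/bnd; exact: subset_itv_oo_cc.
  + exact: cont.
  + rewrite scale0r addr0 subr0 mulrC => eqf.
    by exists c => //; apply: bnd.
- have bnd s : s \in `[h, 0] -> `|s| <= `|h|.
    by rewrite in_itv /= => /andP[s0 sh]; rewrite !ler0_norm ?lerN2.
  have [||c c0h] := @MVT_segment R (fun r => f (x + r *: v)) (fun s => 'D_v f (x + s *: v)) _ _ h0.
  + by move=> s s0h; apply: is_derive_line; apply/df/bnd; exact: subset_itv_oo_cc.
  + exact: cont.
  + rewrite scale0r addr0 sub0r mulrN mulrC => eqf.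
    by exists c; [exact: bnd|rewrite -opprB eqf opprK].
Qed.

Lemma norm_row_le n (x : 'rV[R]_n) (r : R) : 0 <= r ->
  (forall j, `|x 0 j| <= r) -> `|x| <= r.
Proof.
move=> r0 xr; rewrite /Num.Def.normr/= mx_normrE (bigmax_le _ r0)//= => -[i j] _.
by rewrite /= ord1.
Qed.

Lemma ler_norm_coord n (x : 'rV[R]_n) j : `|x 0 j| <= `|x|.
Proof.
rewrite [leRHS]/Num.Def.normr/= mx_normrE.
exact: (le_bigmax _ (fun i : 'I_1 * 'I_n => `|x i.1 i.2|) (0, j)).
Qed.

(* Hadamard's lemma at a point, by telescoping along the coordinates. *)
Lemma partial_slopes n (f : 'rV[R]_n -> R) (U : set 'rV[R]_n) y0 :
  open U -> U y0 ->
  (forall i y, U y -> derivable f y (unit_row R i)) ->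
  (forall i, {for y0, continuous ('D_(unit_row R i) f)}) ->
  exists q : 'I_n -> 'rV[R]_n -> R,
    (forall y, f y - f y0 = \sum_i (y 0 i - y0 0 i) * q i y) /\
    forall i, q i y @[y --> y0] --> 'D_(unit_row R i) f y0.
Proof.
move=> oU Uy0 df cf.
(* The first [k] coordinates come from [y], the others from [y0]: a path from [y0] to [y] that
   changes one coordinate at a time. *)
pose z k (y : 'rV[R]_n) : 'rV[R]_n := \row_j (if (j < k)%N then y 0 j else y0 0 j).
have zS (k : 'I_n) y : z k.+1 y = z k y + (y 0 k - y0 0 k) *: unit_row R k.
  apply/rowP => j; rewrite !mxE /= ltnS leq_eqVlt.
  have [->|jk] := eqVneq j k; first by rewrite eqxx /= ltnn mulr1 addrC subrK.
  by rewrite -val_eqE /= in jk; rewrite (negbTE jk) /= mulr0 addr0.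
(* Where the two coordinates agree the increment is zero and any slope would satisfy the identity;
   the partial derivative at [y0] is the default that also keeps the limit right. *)
pose q (k : 'I_n) (y : 'rV[R]_n) := if y 0 k == y0 0 k then 'D_(unit_row R k) f y0
  else (f (z k.+1 y) - f (z k y)) / (y 0 k - y0 0 k).
exists q; split=> [y|k].
  have z0 : z 0%N y = y0 by apply/rowP => j; rewrite mxE ltn0.
  have zn : z n y = y by apply/rowP => j; rewrite mxE ltn_ord.
  rewrite -[in f y]zn -[in f y0]z0 -(telescope_sumr (fun k => f (z k y))) // big_mkord.
  apply: eq_bigr => k _; rewrite /q; case: eqP => [e|/eqP e].
    by rewrite zS e subrr scale0r addr0 subrr mul0r.
  by rewrite mulrC divfK // subr_eq0.
have [e /= e0 eU] : exists2 e : R, 0 < e & ball y0 e `<=` U.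
  by have /nbhs_ballP := open_nbhs_nbhs (conj oU Uy0).
apply/(@cvgrPdist_le _ _ _ (nbhs y0) (nbhs_filter y0)) => eps eps0.
have /(@cvgrPdist_le _ _ _ (nbhs y0) (nbhs_filter y0)) /(_ _ eps0) /nbhs_ballP [d /= d0 dD] := cf k.
apply/nbhs_ballP; exists (Num.min e d) => /=; first by rewrite lt_min e0.
move=> y; rewrite -ball_normE /= distrC lt_min => /andP[ye yd].
rewrite /q; case: eqP => [_|/eqP nek]; first by rewrite subrr normr0 ltW.
(* In the sup norm the intermediate points of the path are no farther from [y0] than [y] is, so the
   mean value theorem applies inside the ball. *)
have bnd s : `|s| <= `|y 0 k - y0 0 k| ->
    `|z k y + s *: unit_row R k - y0| <= `|y - y0|.
  move=> sk; apply: norm_row_le => // j; rewrite !mxE /=.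
  have [->|jk] := eqVneq j k; rewrite ?eqxx ?mulr1 ?mulr0 ?addr0.
    rewrite ltnn addrAC subrr add0r (le_trans sk) //.
    by have := ler_norm_coord (y - y0) k; rewrite !mxE.
  case: ifP => _; last by rewrite subrr normr0.
  by have := ler_norm_coord (y - y0) j; rewrite !mxE.
have [|s sk fs] := @MVT_line _ f (z k y) (unit_row R k) (y 0 k - y0 0 k).
  move=> s /bnd sk; apply: df; apply: eU.
  by rewrite -ball_normE /= distrC (le_lt_trans sk).
rewrite zS fs mulrAC divff ?subr_eq0 // mul1r.
apply: dD; rewrite -ball_normE /= distrC (le_lt_trans _ yd) //; exact: bnd.
Qed.

(** The slopes of [partial_slopes] turn the difference quotient of [f \o g] into a sum of products,
    each of a difference quotient of a coordinate of [g] and a slope evaluated along [g]; both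
    factors converge. *)
Lemma derive_comp_row (V : normedModType R) n (g : V -> 'rV[R]_n)
    (f : 'rV[R]_n -> R) (U : set 'rV[R]_n) x v :
  open U -> U (g x) ->
  (forall i y, U y -> derivable f y (unit_row R i)) ->
  (forall i, {for g x, continuous ('D_(unit_row R i) f)}) ->
  {for x, continuous g} ->
  derivable g x v ->
  is_derive x v (f \o g) (\sum_i 'D_v g x 0 i * 'D_(unit_row R i) f (g x)).
Proof.
move=> oU Ugx df cf cg dg.
have [q [fq cq]] := partial_slopes oU Ugx df cf.
suff H : (fun h => h^-1 *: (f (g (h *: v + x)) - f (g x))) @ 0^' -->
    \sum_i 'D_v g x 0 i * 'D_(unit_row R i) f (g x).
  split; first by apply/cvg_ex; exists (\sum_i 'D_v g x 0 i * 'D_(unit_row R i) f (g x)).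
  by apply: cvg_lim.
have -> : (fun h => h^-1 *: (f (g (h *: v + x)) - f (g x))) =
  (fun h => \sum_i (h^-1 *: (g (h *: v + x) - g x)) 0 i * q i (g (h *: v + x))).
  apply/funext => h; rewrite fq scaler_sumr; apply: eq_bigr => i _.
  by rewrite !mxE /GRing.scale /= mulrA.
apply: cvg_big => [|i _]; first exact: add_continuous.
apply: cvgM.
  under eq_cvg do rewrite !mxE.
  by rewrite (derive_mx dg) mxE; have /derivable_mxP/(_ 0 i) := dg.
apply: (@cvg_comp _ _ _ (fun h : R => g (h *: v + x)) (q i) _ (nbhs (g x)));
  last exact: cq.
apply: (@cvg_comp _ _ _ (fun h : R => h *: v + x) g _ (nbhs x)); last exact: cg.
have : {for (0 : R), continuous (fun h : R => h *: v + x)}.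
  by apply: continuousD; [exact: scalel_continuous|exact: cst_continuous].
rewrite /prop_for /continuous_at scale0r add0r; move=> H.
by apply: cvg_trans H; apply: cvg_app; exact: cvg_within.
Qed.

End ChainRule.

Section CkComposition.
Context (R : realType).

Lemma C_k_derivable (V W : normedModType R) k (U : set V) (f : V -> W) x v :
  C_k k.+1 U f -> U x -> derivable f x v.
Proof. by move=> [_ /(_ v) [df _]]; exact: df. Qed.

Lemma C_k_derive (V W : normedModType R) k (U : set V) (f : V -> W) v :
  C_k k.+1 U f -> C_k k U ('D_v f).
Proof. by move=> [_ /(_ v) []]. Qed.

Lemma C_k_continuous (V W : normedModType R) k (U : set V) (f : V -> W) x :
  C_k k U f -> U x -> {for x, continuous f}.
Proof. by case: k => [|k] [cf _]; exact: cf. Qed.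

Lemma C_1_derive_comp (V : normedModType R) n (g : V -> 'rV[R]_n)
    (f : 'rV[R]_n -> R) (U : set 'rV[R]_n) x v :
  open U -> U (g x) -> C_k 1 U f -> {for x, continuous g} ->
  derivable g x v ->
  is_derive x v (f \o g) (\sum_i 'D_v g x 0 i * 'D_(unit_row R i) f (g x)).
Proof.
move=> oU Ugx Cf; apply: (derive_comp_row oU Ugx).
  by move=> i y Uy; exact: C_k_derivable Cf Uy.
by move=> i; exact: C_k_continuous (C_k_derive _ Cf) Ugx.
Qed.

(** The chain rule with the identity as inner map. Linearity of ['D_v f x] in [v], which is not
    built into [C_k], comes from here. *)
Lemma C_1_deriveE n (f : 'rV[R]_n -> R) (U : set 'rV[R]_n) x v :
  open U -> U x -> C_k 1 U f ->
  'D_v f x = \sum_i v 0 i * 'D_(unit_row R i) f x.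
Proof.
move=> oU Ux Cf.
have := @C_1_derive_comp _ _ id f U x v oU Ux Cf cvg_id (@derivable_id _ _ x v).
by move=> [_]; rewrite derive_id.
Qed.

(** Induction on the order with [f] generalised: the derivative of the composite involves the
    partial derivatives of [f] composed with the same [g]. *)
Lemma C_k_comp_row (V : normedModType R) n k (g : V -> 'rV[R]_n)
    (f : 'rV[R]_n -> R) (U : set V) (U' : set 'rV[R]_n) :
  open U -> open U' -> (forall x, U x -> U' (g x)) ->
  C_k k U g -> C_k k U' f -> C_k k U (f \o g).
Proof.
move=> oU oU' gU Cg; elim: k f Cg => [|k IH] f Cg Cf.
all: have cfg x : U x -> {for x, continuous (f \o g)}
  by move=> Ux; exact: continuous_comp (C_k_continuous Cg Ux)
                         (C_k_continuous Cf (gU x Ux)).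
  by split.
have C1 (W W' : normedModType R) (D : set W) (h : W -> W') :
    C_k k.+1 D h -> C_k 1 D h.
  by elim: {IH Cg Cf} k h => // k IH h /C_kW; exact: IH.
have dfg v x : U x ->
    is_derive x v (f \o g) (\sum_i 'D_v g x 0 i * 'D_(unit_row R i) f (g x)).
  move=> Ux; apply: (C_1_derive_comp oU' (gU _ Ux) (C1 _ _ _ _ Cf)).
    exact: C_k_continuous Cg Ux.
  exact: C_k_derivable Cg Ux.
split=> // v; split=> [x Ux|]; first by have [] := dfg v x Ux.
apply: (@C_k_ext _ _ _ _ _
  (fun x => \sum_i 'D_v g x 0 i * ('D_(unit_row R i) f \o g) x)) => //.
  by move=> x Ux; have [_ ->] := dfg v x Ux.
apply: C_k_sum => // i _; apply: C_kM => //.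
  by apply: C_k_coord => //; exact: C_k_derive Cg.
by apply: IH (C_kW Cg) (C_k_derive _ Cf).
Qed.

Lemma is_derive_comp1 (V : normedModType R) (g : V -> R) (h : R -> R) x v :
  derivable g x v -> derivable h (g x) 1 ->
  is_derive x v (h \o g) ('D_v g x * 'D_1 h (g x)).
Proof.
move=> dg dh.
have gl : is_derive (0 : R) 1 (fun r => g (x + r *: v)) ('D_v g x).
  by have := @is_derive_line R V _ g x v 0; rewrite scale0r addr0; apply.
have hl : is_derive (g (x + (0 : R) *: v)) 1 h ('D_1 h (g x)).
  by rewrite scale0r addr0; split.
have [dhg Dhg] := is_derive1_comp hl gl.
have dhg' : derivable (h \o g) x v.
  apply/derivable1P; rewrite (_ : (fun r : R => _) = h \o (fun r => g (x + r *: v))) //.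
  by apply/funext => r /=; rewrite addrC.
split=> //.
have := @is_derive_line R V _ (h \o g) x v 0; rewrite scale0r addr0 => /(_ dhg') [_ <-].
by rewrite mulrC -Dhg.
Qed.

Lemma C_k_comp1 (V : normedModType R) k (g : V -> R) (h : R -> R)
    (U : set V) (U' : set R) :
  open U -> (forall x, U x -> U' (g x)) ->
  C_k k U g -> C_k k U' h -> C_k k U (h \o g).
Proof.
move=> oU gU; elim: k h => [|k IH] h Cg Ch.
all: have chg x : U x -> {for x, continuous (h \o g)}
  by move=> Ux; exact: continuous_comp (C_k_continuous Cg Ux)
                         (C_k_continuous Ch (gU x Ux)).
  by split.
have dhg v x : U x -> is_derive x v (h \o g) ('D_v g x * 'D_1 h (g x)).
  move=> Ux; apply: is_derive_comp1; first exact: C_k_derivable Cg Ux.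
  exact: C_k_derivable Ch (gU _ Ux).
split=> // v; split=> [x Ux|]; first by have [] := dhg v x Ux.
apply: (@C_k_ext _ _ _ _ _ (fun x => 'D_v g x * ('D_1 h \o g) x)) => //.
  by move=> x Ux; have [_ ->] := dhg v x Ux.
apply: C_kM => //; first exact: C_k_derive Cg.
by apply: IH (C_kW Cg) (C_k_derive _ Ch).
Qed.

Lemma derive_scale1 (W : normedModType R) (f : R -> W) x v :
  derivable f x 1 -> is_derive x v f (v *: 'D_1 f x).
Proof.
move=> df; have [->|v0] := eqVneq v 0.
  by rewrite scale0r; exact: is_derive0.
have := df => /derivable1_diffP dif.
split; first exact: diff_derivable.
by rewrite !deriveE // -[in LHS](mulr1 v) linearZ.
Qed.

(** On the line every direction is a multiple of 1, so ['D_1] controls all directional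
    derivatives. *)
Lemma C_kS1 k (U : set R) (f : R -> R) : open U ->
  (forall x, U x -> {for x, continuous f}) ->
  (forall x, U x -> derivable f x 1) -> C_k k U ('D_1 f) -> C_k k.+1 U f.
Proof.
move=> oU cf df Cf; split; [exact: cf|move=> v]; split=> [x Ux|].
  by have [] := derive_scale1 v (df x Ux).
apply: C_k_ext (C_kM oU (C_k_cst k U v) Cf) => // x Ux.
by have [_ ->] := derive_scale1 v (df x Ux).
Qed.

Lemma derive_translate (V W : normedModType R) (f : V -> W) (a x v : V) :
  derivable f (x + a) v -> is_derive x v (fun y => f (y + a)) ('D_v f (x + a)).
Proof.
have eqf : (fun h => h^-1 *: (f (h *: v + x + a) - f (x + a))) =
           (fun h => h^-1 *: (f (h *: v + (x + a)) - f (x + a))).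
  by apply/funext => h; rewrite addrA.
by move=> df; split; [rewrite /derivable|rewrite /derive] => /=; rewrite eqf.
Qed.

(** The mean value theorem twice: along [v] for the increment [f (y + h *: w) - f y], and along [w]
    for ['D_v f]. *)
Lemma second_difference (V : normedModType R) (f : V -> R) (U : set V) x v w h :
  C_k 2 U f ->
  (forall s r, `|s| <= `|h| -> `|r| <= `|h| -> U (x + s *: v + r *: w)) ->
  exists s r, [/\ `|s| <= `|h|, `|r| <= `|h| &
    f (x + h *: v + h *: w) - f (x + h *: v) - f (x + h *: w) + f x
    = h * (h * 'D_w ('D_v f) (x + s *: v + r *: w))].
Proof.
move=> Cf Uh.
have Uh0 s : `|s| <= `|h| -> U (x + s *: v).
  by move=> sh; have := Uh s 0 sh; rewrite normr0 scale0r addr0; apply.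
have df s r : `|s| <= `|h| -> `|r| <= `|h| -> derivable f (x + s *: v + r *: w) v.
  by move=> sh rh; exact: C_k_derivable Cf (Uh s r sh rh).
have dphi s : `|s| <= `|h| -> is_derive (x + s *: v) v (fun y => f (y + h *: w) - f y)
    ('D_v f (x + s *: v + h *: w) - 'D_v f (x + s *: v)).
  move=> sh; apply: is_deriveB; first by apply: derive_translate; exact: df.
  by split=> //; exact: C_k_derivable Cf (Uh0 s sh).
have [s sh|s sh eqs] := @MVT_line R V (fun y => f (y + h *: w) - f y) x v h.
  by have [] := dphi s sh.
have [r rh|r rh eqr] := @MVT_line R V ('D_v f) (x + s *: v) w h.
  by apply: C_k_derivable (C_k_derive _ Cf) (Uh s r sh rh).
exists s, r; split=> //.
have [_ e] := dphi s sh; rewrite e eqr in eqs; rewrite -eqs.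
by rewrite opprD opprK !addrA.
Qed.

(** The second difference is symmetric in [v] and [w], so the two mixed derivatives take equal
    values at two points arbitrarily close to [x]; continuity carries the equality to [x]. *)
Lemma derive_comm (V : normedModType R) (f : V -> R) (U : set V) x v w :
  open U -> U x -> C_k 2 U f -> 'D_v ('D_w f) x = 'D_w ('D_v f) x.
Proof.
move=> oU Ux Cf; apply/eqP; rewrite -subr_eq0 -normr_le0.
apply/ler_addgt0Pl => e e0; rewrite addr0.
have e20 : 0 < e / 2 by rewrite divr_gt0.
have cvw a b : {for x, continuous ('D_a ('D_b f))}.
  exact: C_k_continuous (C_k_derive _ (C_k_derive _ Cf)) Ux.
have n1 := (@cvgrPdist_le _ _ _ _ (nbhs_filter x) _ _).1 (cvw v w) _ e20.
have n2 := (@cvgrPdist_le _ _ _ _ (nbhs_filter x) _ _).1 (cvw w v) _ e20.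
have near_d : \forall y \near x, [/\ U y,
    `|'D_v ('D_w f) x - 'D_v ('D_w f) y| <= e / 2 &
    `|'D_w ('D_v f) x - 'D_w ('D_v f) y| <= e / 2].
  have n0 := open_nbhs_nbhs (conj oU Ux).
  by apply: filterS3 n0 n1 n2 => y Uy h1 h2; exact: And3 Uy h1 h2.
have /nbhs_ballP[d /= d0 dP] := near_d.
(* Small enough for all points of the two second differences to stay within [d] of [x]; the [+ 1]
   keeps the denominator positive when [v] and [w] both vanish. *)
pose h := d / (2 * (`|v| + `|w| + 1)).
have vw0 : 0 < `|v| + `|w| + 1 by rewrite ltr_wpDl // addr_ge0.
have h0 : 0 < h by rewrite divr_gt0 // mulr_gt0.
have close a b s r : `|a| + `|b| = `|v| + `|w| -> `|s| <= `|h| -> `|r| <= `|h| ->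
    ball x d (x + s *: a + r *: b).
  move=> ab sh rh; rewrite -ball_normE /= -addrA opprD addNKr normrN.
  rewrite (le_lt_trans (ler_normD _ _)) // !normrZ.
  apply: (@le_lt_trans _ _ (h * (`|a| + `|b|))).
    by rewrite mulrDr lerD // ler_wpM2r // -[leRHS](gtr0_norm h0).
  rewrite ab (@lt_le_trans _ _ (h * (`|v| + `|w| + 1))) //.
    by rewrite ltr_pM2l // ltrDl.
  rewrite /h invfM mulrA -mulrA mulVf ?gt_eqF // mulr1 ler_pdivrMr //.
  by rewrite ler_pMr // ler1n.
have [|s [r [sh rh e1]]] := @second_difference V f U x v w h Cf.
  by move=> s r sh rh; have [] := dP _ (close v w s r erefl sh rh).
have [|s' [r' [sh' rh' e2]]] := @second_difference V f U x w v h Cf.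
  by move=> s' r' sh' rh'; have [] := dP _ (close w v s' r' (addrC _ _) sh' rh').
have key1 (a b c k p q : R) : a - b - c + k = p -> a - c - b + k = q -> p = q.
  by move=> <- <-; congr (_ + _); exact: addrAC.
have key2 (a b c : R) : `|a - c| <= e / 2 -> `|b - c| <= e / 2 -> `|a - b| <= e.
  move=> ac bc; rewrite (splitr e) -(subrKA c) (le_trans (ler_normD _ _)) //.
  by rewrite lerD // distrC.
have swap : f (x + h *: w + h *: v) = f (x + h *: v + h *: w).
  by congr f; exact: addrAC.
rewrite swap in e2.
have /(mulfI (lt0r_neq0 h0)) /(mulfI (lt0r_neq0 h0)) eqD := key1 _ _ _ _ _ _ e1 e2.
have [_ _ b1] := dP _ (close v w s r erefl sh rh).
have [_ b2 _] := dP _ (close w v s' r' (addrC _ _) sh' rh').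
by apply: key2 b2 _; rewrite -eqD; exact: b1.
Qed.

End CkComposition.

(** * A smooth function that is flat at the origin *)

Section FlatFunction.
Context (R : realType).

(* x^-m exp(-1/x) extended by 0; the exponent m makes the family closed under
   differentiation. *)
Definition flat (m : nat) (x : R) : R :=
  if 0 < x then x^-1 ^+ m * expR (- x^-1) else 0.

Lemma flat_le0 m (x : R) : x <= 0 -> flat m x = 0.
Proof. by rewrite /flat; case: ltP. Qed.

Lemma flat_gt0 m (x : R) : 0 < x -> 0 < flat m x.
Proof.
by move=> x0; rewrite /flat x0 mulr_gt0 ?expR_gt0 // exprn_gt0 // invr_gt0.
Qed.

Lemma flat_ge0 m (x : R) : 0 <= flat m x.
Proof. by have [/flat_le0 ->//|/flat_gt0/ltW] := leP x 0. Qed.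

(** With u = 1/x, one term of the exponential series gives u^(m+1) / (m+1)! <= exp u, that is u^m
    exp(-u) <= (m+1)! x. *)
Lemma flat_le m (x : R) : `|flat m x| <= (m.+1)`!%:R * `|x|.
Proof.
have [x0|x0] := leP x 0; first by rewrite flat_le0 // normr0 mulr_ge0.
rewrite (gtr0_norm x0) gtr0_norm ?flat_gt0 // /flat x0.
have : 0 < x^-1 by rewrite invr_gt0.
rewrite -[X in _ <= _ * X](invrK x); move: x^-1 => u u0.
have f0 : (0 : R) < (m.+1)`!%:R by rewrite ltr0n fact_gt0.
have e1 := expR_ge1Dxn m (ltW u0).
have e2 : u ^+ m.+1 / (m.+1)`!%:R <= expR u by apply: le_trans e1; rewrite lerDr.
rewrite expRN ler_pdivrMr ?expR_gt0 // mulrAC ler_pdivlMr // -exprSr.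
by rewrite -ler_pdivrMl // mulrC.
Qed.

Lemma is_derive_pow_expN m (u : R) :
  is_derive u 1 (fun v => v ^+ m * expR (- v))
    (m%:R * u ^+ m.-1 * expR (- u) - u ^+ m * expR (- u)).
Proof.
have d1 : is_derive u 1 (fun v : R => v ^+ m) (m%:R * u ^+ m.-1).
  split; first exact: exprn_derivable.
  by rewrite exp_derive /GRing.scale /= mulr1.
have d2 : is_derive u 1 (expR \o -%R) (expR (- u) * -1).
  by apply: is_derive1_comp; exact: is_deriveNid.
have := is_deriveM d1 d2; rewrite /GRing.scale /= mulrN1 mulrN.
by rewrite addrC [expR _ * _]mulrC.
Qed.

Lemma is_derive_flat m (x : R) :
  is_derive x 1 (flat m) (flat m.+2 x - m%:R * flat m.+1 x).
Proof.
have [x0|x0|->] := ltrgtP x 0.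
- rewrite !flat_le0 ?ltW // mulr0 subr0.
  apply: (@near_eq_is_derive _ _ _ (fun=> 0)).
    by apply: (@near_open _ _ _ _ (@open_lt R 0)) => // y /= y0; rewrite flat_le0 // ltW.
- apply: (@near_eq_is_derive _ _ _
            ((fun u => u ^+ m * expR (- u)) \o (fun y : R => y^-1))).
    by apply: (@near_open _ _ _ _ (@open_gt R 0)) => // y /= y0; rewrite /flat ifT.
  have dV : is_derive x 1 (fun y : R => y^-1) (- x ^- 2).
    have := @is_deriveV R id x 1 1 (lt0r_neq0 x0) (is_derive_id _ _).
    by rewrite /GRing.scale /= mulr1.
  have := is_derive1_comp (is_derive_pow_expN m x^-1) dV.
  congr is_derive; rewrite /flat x0 -exprVn; move: (x^-1) (expR _) => u E.
  by case: m => [|m] /=; rewrite ?mul0r ?expr0 -?pred_Sn !exprS; ring.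
- rewrite !flat_le0 // mulr0 subr0.
  suff H : (fun h : R => h^-1 *: (flat m (h *: 1 + 0) - flat m 0)) @ 0^' --> (0 : R).
    by split; [apply/cvg_ex; exists 0|apply: cvg_lim].
  (* At the origin the difference quotient of [flat m] is [flat m.+1] itself, which tends to 0 by
     [flat_le]. *)
  apply: (@cvg_trans _ (flat m.+1 h @[h --> (0 : R)^'])).
    apply: near_eq_cvg; apply: cvg_within; near=> h.
    rewrite addr0 [h *: 1]mulr1 (flat_le0 m (lexx 0)) subr0 /GRing.scale /= /flat.
    by case: ifP => _; rewrite ?mulr0 // exprS mulrA.
  apply: cvg_trans; first by apply: cvg_app; exact: cvg_within.
  apply/cvgrPdist_le => e e0; near=> h.
  rewrite sub0r normrN (le_trans (flat_le _ _)) //.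
  rewrite -ler_pdivlMl ?ltr0n ?fact_gt0 //; near: h.
  apply/nbhs_ballP; exists ((m.+2)`!%:R^-1 * e) => /=.
    by rewrite mulr_gt0 // invr_gt0 ltr0n fact_gt0.
  by move=> h; rewrite -ball_normE /= sub0r normrN => /ltW.
Unshelve. all: by end_near. Qed.

Lemma C_k_flat k m (U : set R) : open U -> C_k k U (flat m).
Proof.
move=> oU; elim: k m => [|k IH] m.
all: have cf x : U x -> {for x, continuous (flat m)}
  by move=> _; apply/differentiable_continuous/derivable1_diffP;
     have [] := is_derive_flat m x.
  by split.
apply: C_kS1 => //; first by move=> x _; have [] := is_derive_flat m x.
apply: (@C_k_ext _ _ _ _ _ (fun x => flat m.+2 x + (- m%:R) * flat m.+1 x)) => //.
  by move=> x _; have [_ ->] := is_derive_flat m x; rewrite mulNr.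
by apply: C_kD => //; apply: C_kM => //; exact: C_k_cst.
Qed.

End FlatFunction.

(** The inverse function theorem in one variable. It serves to recover the parameter of the loop
    from one of its coordinates. *)
Lemma smooth_local_inverse (R : realType) (h : R -> R) (O : set R) (t0 : R) :
  open O -> O t0 -> smooth O h -> 'D_1 h t0 != 0 ->
  exists (tau : R -> R) (V : set R), [/\ open V /\ V (h t0), smooth V tau,
    forall y, V y -> O (tau y) & \forall t \near t0, tau (h t) = t].
Proof.
move=> oO Ot0 Ch h'0.
have ch' : {for t0, continuous ('D_1 h)}.
  exact: C_k_continuous (C_k_derive (1 : R) (Ch 1%N)) Ot0.
have [d /= d0 dP] : exists2 d : R, 0 < d &
    ball t0 d `<=` [set t | O t /\ 'D_1 h t != 0].
  have n1 := open_nbhs_nbhs (conj oO Ot0).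
  have n2 := (@cvgrPdist_lt _ _ _ _ (nbhs_filter t0) _ _).1 ch' `|'D_1 h t0|.
  rewrite normr_gt0 in n2.
  have n12 : nbhs t0 [set t | O t /\ 'D_1 h t != 0].
    apply: filterS2 n1 (n2 h'0) => t Ot ht; split=> //.
    by apply: contraTneq ht => ->; rewrite subr0 ltxx.
  by have /nbhs_ballP[d d0 dP] := n12; exists d.
(* Two points of [B] are less than 2d/3 apart, so the symmetric range of [MVT_line] around either of
   them stays in the ball of radius [d], where the derivative does not vanish. *)
pose B := ball t0 (d / 3).
have d30 : 0 < d / 3 by rewrite divr_gt0.
have oB : open B by exact: ball_open.
have BO t : B t -> O t /\ 'D_1 h t != 0.
  move=> Bt; apply: dP; apply: le_ball Bt.
  by rewrite ler_pdivrMr // ler_peMr ?ler1n // ltW.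
have Bt0 : B t0 by exact: ballxx.
have hI s t : B s -> B t -> h s = h t -> s = t.
  move=> Bs Bt hst.
  have inD r : `|r| <= `|t - s| -> ball t0 d (s + r *: 1).
    move=> rts; rewrite -ball_normE /= [r *: 1]mulr1.
    move: Bs Bt; rewrite /B -!ball_normE /= => Bs Bt.
    rewrite opprD addrA (le_lt_trans (ler_normB _ _)) //.
    by have := ler_distD t0 t s; rewrite (distrC t t0); lra.
  have [|r rts] := @MVT_line R _ h s 1 (t - s).
    by move=> r /inD/dP [Or _]; exact: C_k_derivable (Ch 1%N) Or.
  rewrite [_ *: 1]mulr1 [s + _]addrC subrK hst subrr => /esym/eqP.
  have [_ h'] := dP _ (inD r rts).
  by rewrite mulf_eq0 (negbTE h') orbF subr_eq0 => /eqP.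
pose tau y := xget t0 [set t | B t /\ h t = y].
have tauK t : B t -> tau (h t) = t.
  move=> Bt; rewrite /tau; case: xgetP => [s -> [Bs hst]|/(_ t)]; first exact: hI.
  by move=> /(_ (conj Bt erefl)).
have ch t : B t -> {for t, continuous h}.
  by move=> /BO [Ot _]; exact: C_k_continuous (Ch 0%N) Ot.
have nearK t : B t -> {near t, cancel h tau}.
  by move=> Bt; apply: (near_open oB Bt) => s; exact: tauK.
have nearc t : B t -> {near t, continuous h}.
  by move=> Bt; apply: (near_open oB Bt) => s; exact: ch.
have ctau t : B t -> {for h t, continuous tau}.
  move=> Bt; have [+ _] := near_can_continuousAcan_sym (nearK t Bt) (nearc t Bt).
  exact: nbhs_singleton.
have dtau t : B t -> is_derive (h t) 1 tau ('D_1 h t)^-1.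
  move=> Bt; have [Ot h't] := BO t Bt.
  apply: is_derive_inverse (nearK t Bt) (nearc t Bt) _ h't.
  by split=> //; exact: C_k_derivable (Ch 1%N) Ot.
have oV : open (h @` B).
  rewrite openE => _ [t Bt <-].
  have [_ K] := near_can_continuousAcan_sym (nearK t Bt) (nearc t Bt).
  have nB : \forall y \near h t, B (tau y).
    apply: (ctau t Bt); apply: open_nbhs_nbhs; split; first exact: oB.
    by rewrite tauK.
  apply: filterS (filterI K nB) => y [Ky By]; exists (tau y) => //.
exists tau, (h @` B); split.
- by split; [exact: oV|exists t0].
(* Bootstrap: the derivative of [tau] is the inverse of ['D_1 h \o tau], hence of class C^k as soon
   as [tau] is. *)
- elim=> [|k IH]; first by split=> // _ [t Bt <-]; exact: ctau.
  apply: C_kS1 => //.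
  + by move=> _ [t Bt <-]; exact: ctau.
  + by move=> _ [t Bt <-]; have [] := dtau t Bt.
  apply: (@C_k_ext _ _ _ _ _ (fun y => (('D_1 h \o tau) y)^-1)) => //.
    by move=> _ [t Bt <-]; rewrite /= tauK //; have [_ ->] := dtau t Bt.
  apply: C_kV => //.
    by move=> _ [t Bt <-]; rewrite /= tauK //; have [] := BO t Bt.
  apply: (@C_k_comp1 _ _ _ _ _ _ O) => //.
    by move=> _ [t Bt <-]; rewrite /= tauK //; have [] := BO t Bt.
  exact: C_k_derive (Ch k.+1).
- by move=> _ [t Bt <-]; rewrite tauK //; have [] := BO t Bt.
- exact: near_open oB Bt0 tauK.
Qed.

(** * Charts *)

Section SmoothFunctions.
Context (R : realType) (V : normedModType R) (U : set V) (oU : open U).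

Lemma smooth_ext (W : normedModType R) (f g : V -> W) :
  (forall x, U x -> f x = g x) -> smooth U f -> smooth U g.
Proof. by move=> fg sf k; exact: C_k_ext fg (sf k). Qed.

Lemma smooth_sub (W : normedModType R) (U' : set V) (f : V -> W) :
  U' `<=` U -> smooth U f -> smooth U' f.
Proof. by move=> sU sf k; exact: C_k_sub sU (sf k). Qed.

Lemma smooth_cst (W : normedModType R) (a : W) : smooth U (fun=> a).
Proof. by move=> k; exact: C_k_cst. Qed.

Lemma smoothD (f g : V -> R) :
  smooth U f -> smooth U g -> smooth U (fun x => f x + g x).
Proof. by move=> sf sg k; exact: C_kD oU (sf k) (sg k). Qed.

Lemma smoothM (f g : V -> R) :
  smooth U f -> smooth U g -> smooth U (fun x => f x * g x).
Proof. by move=> sf sg k; exact: C_kM oU (sf k) (sg k). Qed.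

Lemma smoothN (f : V -> R) : smooth U f -> smooth U (fun x => - f x).
Proof.
move=> sf; apply: (smooth_ext _ (smoothM (smooth_cst (-1 : R)) sf)) => x _.
exact: mulN1r.
Qed.

Lemma smoothV (f : V -> R) : (forall x, U x -> f x != 0) ->
  smooth U f -> smooth U (fun x => (f x)^-1).
Proof. by move=> f0 sf k; exact: C_kV oU f0 (sf k). Qed.

Lemma smooth_sum (I : Type) (r : seq I) (P : pred I) (f : I -> V -> R) :
  (forall i, P i -> smooth U (f i)) ->
  smooth U (fun x => \sum_(i <- r | P i) f i x).
Proof. by move=> sf k; apply: C_k_sum => // i Pi; exact: sf. Qed.

Lemma smooth_coord n (f : V -> 'rV[R]_n) j :
  smooth U f -> smooth U (fun x => f x 0 j).
Proof. by move=> sf k; exact: C_k_coord oU (sf k). Qed.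

Lemma smooth_row n (f : V -> 'rV[R]_n) :
  (forall j, smooth U (fun x => f x 0 j)) -> smooth U f.
Proof. by move=> sf k; apply: C_k_row => // j; exact: sf. Qed.

Lemma smooth_derive (W : normedModType R) (f : V -> W) v :
  smooth U f -> smooth U ('D_v f).
Proof. by move=> sf k; exact: C_k_derive (sf k.+1). Qed.

Lemma smooth_comp n (W : set 'rV[R]_n) (g : V -> 'rV[R]_n)
    (f : 'rV[R]_n -> R) :
  open W -> (forall x, U x -> W (g x)) ->
  smooth U g -> smooth W f -> smooth U (f \o g).
Proof. by move=> oW gW sg sf k; exact: C_k_comp_row oU oW gW (sg k) (sf k). Qed.

Lemma smooth_comp1 (W : set R) (g : V -> R) (h : R -> R) :
  (forall x, U x -> W (g x)) ->
  smooth U g -> smooth W h -> smooth U (h \o g).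
Proof. by move=> gW sg sh k; exact: C_k_comp1 oU gW (sg k) (sh k). Qed.

Lemma smooth_derivable (W : normedModType R) (f : V -> W) x v :
  smooth U f -> U x -> derivable f x v.
Proof. by move=> sf; exact: C_k_derivable (sf 1%N). Qed.

Lemma smooth_continuous (W : normedModType R) (f : V -> W) x :
  smooth U f -> U x -> {for x, continuous f}.
Proof. by move=> sf; exact: C_k_continuous (sf 0%N). Qed.

End SmoothFunctions.

Section ChainRuleRow.
Context (R : realType).

Lemma derive_coord (V : normedModType R) m (f : V -> 'rV[R]_m) x v j :
  derivable f x v -> 'D_v f x 0 j = 'D_v (fun y => f y 0 j) x.
Proof. by move=> df; rewrite derive_mx // mxE. Qed.

Lemma smooth_deriveE n (f : 'rV[R]_n -> R) (U : set 'rV[R]_n) x v :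
  open U -> U x -> smooth U f ->
  'D_v f x = \sum_i v 0 i * 'D_(unit_row R i) f x.
Proof. by move=> oU Ux sf; exact: C_1_deriveE oU Ux (sf 1%N). Qed.

Lemma smooth_derive_linear n m (f : 'rV[R]_n -> 'rV[R]_m) (U : set 'rV[R]_n) x
    (c : R) v w :
  open U -> U x -> smooth U f ->
  'D_(c *: v + w) f x = c *: 'D_v f x + 'D_w f x.
Proof.
move=> oU Ux sf; apply/rowP => j; rewrite !mxE.
have sfj := smooth_coord oU j sf.
have df u : derivable f x u by exact: smooth_derivable sf Ux.
have E u := smooth_deriveE u oU Ux sfj.
rewrite (derive_coord _ (df (c *: v + w))) (derive_coord _ (df v)).
rewrite (derive_coord _ (df w)) (E (c *: v + w)) (E v) (E w) mulr_sumr -big_split /=; apply: eq_bigr => i _.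
by rewrite !mxE mulrDl mulrA.
Qed.

Lemma is_derive_comp_smooth (V : normedModType R) n (g : V -> 'rV[R]_n)
    (f : 'rV[R]_n -> R) (U : set 'rV[R]_n) x v :
  open U -> U (g x) -> smooth U f -> {for x, continuous g} ->
  derivable g x v -> is_derive x v (f \o g) ('D_('D_v g x) f (g x)).
Proof.
move=> oU Ugx sf cg dg; rewrite (smooth_deriveE _ oU Ugx sf).
exact: C_1_derive_comp oU Ugx (sf 1%N) cg dg.
Qed.

Lemma derive_comp_smooth_row (V : normedModType R) n m (g : V -> 'rV[R]_n)
    (f : 'rV[R]_n -> 'rV[R]_m) (U : set 'rV[R]_n) x v :
  open U -> U (g x) -> smooth U f -> {for x, continuous g} ->
  derivable g x v -> is_derive x v (f \o g) ('D_('D_v g x) f (g x)).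
Proof.
move=> oU Ugx sf cg dg.
have Dj j := is_derive_comp_smooth oU Ugx (smooth_coord oU j sf) cg dg.
have dfg : derivable (f \o g) x v.
  by apply/derivable_mxP => i j; rewrite ord1; have [] := Dj j.
split; first exact: dfg.
apply/rowP => j; rewrite (derive_coord _ dfg).
rewrite derive_coord; last exact: smooth_derivable sf Ugx.
by have [_ <-] := Dj j.
Qed.

End ChainRuleRow.

Lemma open_preimage_in (T S : topologicalType) (A : set T) (B : set S) (f : T -> S) :
  open A -> open B -> (forall x, A x -> {for x, continuous f}) ->
  open (A `&` f @^-1` B).
Proof.
move=> oA oB cf; rewrite openE => x [Ax Bfx]; apply: filterI.
  exact: open_nbhs_nbhs.
by apply: (cf x Ax); exact: open_nbhs_nbhs.
Qed.

Section Charts.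
Context (R : realType) (n : nat) (M : smoothManifold R n).
Implicit Types (e f h : chart R n M) (p : M) (v w x : 'rV[R]_n).

Definition overlap e f : set 'rV[R]_n := target e `&` param e @^-1` source f.

Lemma open_chart_preimage e (U : set M) : open U ->
  open (target e `&` param e @^-1` U).
Proof.
move=> oU; apply: open_preimage_in oU _; first exact: open_target.
exact: param_continuous.
Qed.

Lemma open_overlap e f : open (overlap e f).
Proof. by apply: open_chart_preimage; exact: open_source. Qed.

Lemma overlap_coords e f p : source e p -> source f p -> overlap e f (e p).
Proof. by move=> ep fp; split; [exact: coords_target|rewrite /= coordsK]. Qed.

Lemma smooth_overlap e f : atlas M e -> atlas M f ->
  smooth (overlap e f) (f \o param e).
Proof. exact: smooth_transition. Qed.

Lemma trans_id e x w : target e x -> 'D_w (e \o param e) x = w.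
Proof.
move=> ex; rewrite (@near_eq_derive _ _ _ _ id) ?derive_id //.
by apply: (near_open (@open_target _ _ _ e) ex) => y; exact: paramK.
Qed.

(** The four change-of-chart rules between [coord_vector] and [dchart] below are all instances, with
    [chart_at p] among the three charts. *)
Lemma trans_comp e f h x w : atlas M e -> atlas M f -> atlas M h ->
  overlap e f x -> source h (param e x) ->
  'D_w (h \o param e) x =
  'D_('D_w (f \o param e) x) (h \o param f) (f (param e x)).
Proof.
move=> ae af ah efx hx; have [ex fx] := efx.
have sef := smooth_overlap ae af.
have [_ <-] := @derive_comp_smooth_row _ _ _ _ (f \o param e) (h \o param f)
  (overlap f h) x w (@open_overlap f h) (overlap_coords fx hx)
  (smooth_overlap af ah) (smooth_continuous sef efx) (@smooth_derivable _ _ _ _ _ x w sef efx).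
have eqf y : overlap e f y ->
    (h \o param e) y = ((h \o param f) \o (f \o param e)) y.
  by move=> [_ fy] /=; rewrite coordsK.
by apply: near_eq_derive; exact: (near_open (@open_overlap e f) efx eqf).
Qed.

(** The differential of the chart [e] at [p], inverse to [coord_vector e p]: it turns components in
    [chart_at p] into components in [e]. *)
Definition dchart e p v : 'rV[R]_n :=
  'D_v (e \o param (chart_at p)) (chart_at p p).

Lemma dchartK e p w : atlas M e -> source e p ->
  dchart e p (coord_vector e p w) = w.
Proof.
move=> ae ep; rewrite -[RHS](@trans_id e (e p)); last exact: coords_target.
have := @trans_comp e (chart_at p) e (e p) w ae (chart_at_atlas p) ae
  (overlap_coords ep (chart_at_source p)).
by rewrite (coordsK ep) => ->.
Qed.

Lemma coord_vectorK e p v : atlas M e -> source e p ->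
  coord_vector e p (dchart e p v) = v.
Proof.
move=> ae ep; have cp := chart_at_source p; have ac := chart_at_atlas p.
rewrite -[RHS](@trans_id (chart_at p) (chart_at p p)); last exact: coords_target.
have := @trans_comp _ e _ (chart_at p p) v ac ae ac (overlap_coords cp ep).
by rewrite (coordsK cp) => ->.
Qed.

Lemma dchart_coord_vector e f p w : atlas M e -> atlas M f ->
  source e p -> source f p ->
  dchart f p (coord_vector e p w) = 'D_w (f \o param e) (e p).
Proof.
move=> ae af ep fp; have cp := chart_at_source p.
have := @trans_comp e (chart_at p) f (e p) w ae (chart_at_atlas p) af
  (overlap_coords ep cp).
by rewrite (coordsK ep) => ->.
Qed.

Lemma coord_vector_trans e f p w : atlas M e -> atlas M f ->
  source e p -> source f p ->
  coord_vector e p w = coord_vector f p ('D_w (f \o param e) (e p)).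
Proof.
move=> ae af ep fp; have cp := chart_at_source p.
have := @trans_comp e f (chart_at p) (e p) w ae af (chart_at_atlas p)
  (overlap_coords ep fp).
by rewrite (coordsK ep); apply.
Qed.

Lemma dchart_linear e p (c : R) v w : atlas M e -> source e p ->
  dchart e p (c *: v + w) = c *: dchart e p v + dchart e p w.
Proof.
move=> ae ep; apply: smooth_derive_linear (smooth_overlap (chart_at_atlas p) ae).
  exact: open_overlap.
exact: overlap_coords (chart_at_source p) ep.
Qed.

Lemma coord_vector_linear e p (c : R) v w : atlas M e -> source e p ->
  coord_vector e p (c *: v + w) = c *: coord_vector e p v + coord_vector e p w.
Proof.
move=> ae ep; apply: smooth_derive_linear (smooth_overlap ae (chart_at_atlas p)).
  exact: open_overlap.
exact: overlap_coords ep (chart_at_source p).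
Qed.

Lemma dchart_eq0 e p v : atlas M e -> source e p ->
  (dchart e p v == 0) = (v == 0).
Proof.
move=> ae ep; apply/eqP/eqP => [v0|->]; last by rewrite /dchart derive0.
by rewrite -(coord_vectorK v ae ep) v0 /coord_vector derive0.
Qed.

Lemma dchart_velocity e (gamma : R -> M) t : smooth_curve gamma -> atlas M e ->
  source e (gamma t) ->
  dchart e (gamma t) (velocity gamma t) = derive1 (e \o gamma) t.
Proof.
move=> [cg sg] ae et; have cs := chart_at_source (gamma t).
have ac := chart_at_atlas (gamma t).
have oU : open (gamma @^-1` source (chart_at (gamma t))).
  by apply: open_comp; [move=> s _; exact: cg|exact: open_source].
have sc := sg _ ac.
rewrite /dchart /velocity !derive1E.
have [_ <-] := @derive_comp_smooth_row R R _ _ (chart_at (gamma t) \o gamma)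
  (e \o param (chart_at (gamma t))) (overlap (chart_at (gamma t)) e) t 1
  (@open_overlap _ _) (overlap_coords cs et) (smooth_overlap ac ae)
  (smooth_continuous sc cs) (@smooth_derivable _ _ _ _ _ t 1 sc cs).
apply: near_eq_derive; apply: (near_open oU cs) => s cs' /=.
by rewrite coordsK.
Qed.

End Charts.

(** * Partitions of unity *)

Section Bumps.
Context (R : realType) (n : nat) (M : smoothManifold R n).

Definition smooth_fun (F : M -> R) : Prop :=
  forall e, atlas M e -> smooth (target e) (F \o param e).

(** The open sets [U] and the complement of [K] cover the target; [G] is smooth on the first and
    zero on the second. *)
Lemma smooth_zero_extension (e : chart R n M) (G : 'rV[R]_n -> R) (K U : set M) :
  closed K -> open U -> K `<=` U ->
  smooth (target e `&` param e @^-1` U) G ->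
  (forall x, target e x -> ~ K (param e x) -> G x = 0) ->
  smooth (target e) G.
Proof.
move=> cK oU KU sG G0 k.
have oKC : open (target e `&` param e @^-1` (~` K)).
  by apply: open_chart_preimage; exact: closed_openC.
have s0 : C_k k (target e `&` param e @^-1` (~` K)) G.
  by apply: (C_k_ext oKC _ (C_k_cst k _ (0 : R))) => x [ex Kx]; rewrite G0.
apply: C_k_sub (C_kU (sG k) s0) => x ex.
by have [/KU Ux|nK] := pselect (K (param e x)); [left|right].
Qed.

(** [K] is the image of a closed cube under [param e]. It is compact, hence closed in the Hausdorff
    space [M], which is what extension by zero beyond the source of [e] requires. *)
Lemma exists_bump (e : chart R n M) (W : set M) (p0 : M) :
  atlas M e -> source e p0 -> open W -> W p0 ->
  exists (phi : M -> R) (K : set M),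
    [/\ smooth_fun phi, forall p, 0 <= phi p, 0 < phi p0, closed K &
        K `<=` source e `&` W /\ forall p, ~ K p -> phi p = 0].
Proof.
move=> ae ep0 oW Wp0; pose y0 := e p0.
have [d /= d0 dP] : exists2 d : R, 0 < d &
    ball y0 d `<=` target e `&` param e @^-1` W.
  apply/nbhs_ballP; apply: open_nbhs_nbhs; split.
    exact: open_chart_preimage.
  by split; [exact: coords_target|rewrite /= coordsK].
pose r := d / 2; have r0 : 0 < r by rewrite divr_gt0.
pose K' := [set y : 'rV[R]_n | forall j, `[y0 0 j - r, y0 0 j + r]%classic (y 0 j)].
have K'ball y : K' y -> ball y0 d y.
  move=> K'y; rewrite -ball_normE /= distrC; apply: (@le_lt_trans _ _ r).
    apply: norm_row_le => [|j]; first exact: ltW.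
    by have := K'y j; rewrite /= in_itv /= !mxE ler_distl.
  by rewrite ltr_pdivrMr // ltr_pMr // ltr1n.
pose K := param e @` K'.
have cK : closed K.
  apply: compact_closed; first exact: hausdorffM.
  apply: continuous_compact; last first.
    exact: (@rV_compact R n (fun j => `[y0 0 j - r, y0 0 j + r]%classic)
              (fun j => @segment_compact _ _ _)).
  apply: continuous_in_subspaceT => y /set_mem /K'ball/dP [ey _].
  exact: param_continuous.
(* A polynomial, unlike the sup norm. It is positive on the open Euclidean ball of radius [r], which
   lies inside the cube [K']. *)
pose q (y : 'rV[R]_n) := r ^+ 2 - \sum_j (y 0 j - y0 0 j) ^+ 2.
pose phi p := if p \in source e then flat 0 (q (e p)) else 0.
have phiK p : ~ K p -> phi p = 0.
  move=> nK; rewrite /phi; case: ifP => // /set_mem ep; apply: flat_le0.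
  rewrite leNgt; apply/negP; rewrite subr_gt0 => lt_r; apply: nK.
  exists (e p); last exact: coordsK.
  move=> j; rewrite /= in_itv /= -ler_distl.
  rewrite -ler_sqr ?nnegrE ?normr_ge0 ?(ltW r0) // real_normK ?num_real //.
  apply: le_trans (ltW lt_r); rewrite (bigD1 j) //= lerDl.
  by apply: sumr_ge0 => i _; exact: sqr_ge0.
exists phi, K; split; [| | |exact: cK|].
- move=> f af; apply: (@smooth_zero_extension _ _ K (source e)) => //.
  + exact: open_source.
  + by move=> _ [y /K'ball/dP [ey _] <-]; exact: param_source.
  + have sef := smooth_overlap af ae; have oU := @open_overlap _ _ _ f e.
    apply: (@smooth_ext _ _ _ oU _ (flat 0 \o (q \o (e \o param f)))).
      by move=> x [_ ex]; rewrite /phi /= mem_set.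
    apply: (@smooth_comp1 _ _ _ oU setT) => //; last first.
      by move=> k; apply: C_k_flat; exact: openT.
    have s1 j : smooth (overlap f e) (fun x => (e \o param f) x 0 j + - y0 0 j).
      have h1 := smooth_coord oU j sef.
      have h2 : smooth (overlap f e) (fun=> - y0 0 j) by exact: smooth_cst.
      exact: (smoothD oU h1 h2).
    have s2 := @smooth_sum _ _ _ oU _ (index_enum 'I_n) xpredT _
      (fun j _ => smoothM oU (s1 j) (s1 j)).
    have s3 : smooth (overlap f e) (fun=> r ^+ 2) by exact: smooth_cst.
    exact: (smooth_ext oU _ (smoothD oU s3 (smoothN oU s2))).
  + by move=> x _; exact: phiK.
- by move=> p; rewrite /phi; have [_|_] := boolP (p \in source e); rewrite ?flat_ge0.
- rewrite /phi mem_set //; apply: flat_gt0; rewrite /q big1 ?subr0 ?exprn_gt0 //.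
  by move=> j _; rewrite subrr expr0n.
- split; last exact: phiK.
  move=> _ [y /K'ball/dP [ey Wy] <-]; split=> //; exact: param_source.
Qed.

End Bumps.

Lemma smooth_id (R : realType) (V : normedModType R) (U : set V) : smooth U id.
Proof.
case=> [|k]; split=> //; try by move=> x _; exact: cvg_id.
move=> v; split=> [x _|]; first exact: derivable_id.
rewrite (_ : 'D_v id = fun=> v); first exact: C_k_cst.
by apply/funext => x; exact: derive_id.
Qed.

(** * Local extension of the velocity of an embedded loop *)

Section Periodicity.
Context (R : realType) (n : nat) (M : smoothManifold R n).
Context (T : R) (gamma : R -> M).
Hypothesis emb : embedded_loop T gamma.

Lemma loop_periodic t (k : int) : gamma (t + k%:~R * T) = gamma t.
Proof.
have [[_ per] _ _ _ _] := emb.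
have pern (m : nat) s : gamma (s + m%:R * T) = gamma s.
  elim: m s => [|m IH] s; first by rewrite mul0r addr0.
  by rewrite -addn1 natrD mulrDl mul1r addrA per IH.
case: k => m; first exact: pern.
by rewrite NegzE mulrNz mulNr -[in RHS](subrK (m.+1%:R * T) t) pern.
Qed.

Lemma loop_range_closed : closed (range gamma).
Proof.
have [[T0 _] [cg _] _ _ _] := emb.
apply: compact_closed; first exact: hausdorffM.
rewrite (_ : range gamma = gamma @` `[0, T]%classic).
  apply: continuous_compact; last exact: segment_compact.
  exact: continuous_subspaceT.
rewrite eqEsubset; split=> [_ [t _ <-]|_ [t _ <-]]; last by exists t.
exists (t + (- Num.floor (t / T))%:~R * T); last exact: loop_periodic.
have := floor_itv (t / T); rewrite intrD ler_pdivlMr // ltr_pdivrMr //.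
by rewrite /= in_itv /= mulrNz => /andP[h1 h2]; apply/andP; split; lra.
Qed.

(** Off the loop, whose range is closed, the zero field does. At a loop point some coordinate k of x
    = [e \o gamma] has nonzero derivative, so the parameter is locally a smooth function [tau] of
    that coordinate, and x' evaluated at [tau (y 0 k)] is the field: it depends on one coordinate of
    y only. *)
Lemma local_velocity_field (e : chart R n M) p0 :
  atlas M e -> source e p0 ->
  exists (W : set M) (b : 'rV[R]_n -> 'rV[R]_n),
    [/\ open W, W p0, W `<=` source e,
        smooth (target e `&` param e @^-1` W) b &
        forall t, W (gamma t) -> b (e (gamma t)) = derive1 (e \o gamma) t].
Proof.
move=> ae ep0; have [[T0 per] sc v0 _ near_loop] := emb.
have [[t0 _ gt0]|p0gamma] := pselect (range gamma p0); last first.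
  exists (source e `&` ~` range gamma), (fun=> 0); split=> //.
  - apply: openI; first exact: open_source.
    exact/closed_openC/loop_range_closed.
  - exact: smooth_cst.
  - by move=> t [_ []]; exists t.
have [cg sg] := sc; have se := sg e ae.
subst p0; pose x := e \o gamma; pose O := gamma @^-1` source e.
have oO : open O by apply: open_comp; [move=> s _; exact: cg|exact: open_source].
have x'0 : derive1 x t0 != 0.
  by rewrite -(dchart_velocity sc ae ep0) dchart_eq0.
have [k x'k] : exists k, derive1 x t0 0 k != 0.
  by move: x'0 => /rV0Pn.
have sx' : smooth O (derive1 x).
  rewrite (_ : derive1 x = 'D_1 x); last by apply/funext => t; exact: derive1E.
  exact: smooth_derive.
have sh : smooth O (fun t => x t 0 k) by exact: smooth_coord.
have [|tau [V [[oV Vt0] stau tauO tauK]]] := smooth_local_inverse oO ep0 sh.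
  rewrite -(@derive_coord _ _ _ _ _ _ k) -?derive1E //.
  exact: smooth_derivable se ep0.
have [d /= d0 dP] : exists2 d : R, 0 < d &
    ball t0 d `<=` [set t | tau (x t 0 k) = t] by exact/nbhs_ballP.
have oP : open (source e `&` (fun p => e p 0 k) @^-1` V).
  apply: open_preimage_in => //; first exact: open_source.
  move=> p ep.
  exact: (continuous_comp (coords_continuous ep) (@coord_continuous _ _ _ _ _ _)).
(* The first set keeps away other strands: all loop parameters of its points are within [d] of [t0]
   modulo [T]. Embeddedness makes it a neighbourhood of the point. The second confines coordinate
   [k] to the domain of [tau]. *)
exists ([set p | forall s, gamma s = p ->
    exists k : int, `|s - t0 - k%:~R * T| < d]^° `&`
  (source e `&` (fun p => e p 0 k) @^-1` V)).
exists (fun y => derive1 x (tau (y 0 k))); split.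
- by apply: openI oP; exact: open_interior.
- by split; [exact: near_loop|split].
- by move=> p [_ []].
- have oU : open (target e `&` param e @^-1` (source e `&` (fun p => e p 0 k) @^-1` V)).
    exact: open_chart_preimage.
  apply: (@smooth_sub _ _ (target e `&` param e @^-1` (source e `&` (fun p => e p 0 k) @^-1` V))).
    by move=> y [ey [_ yV]].
  have UV y : (target e `&` param e @^-1` (source e `&` (fun p => e p 0 k) @^-1` V)) y ->
      V (y 0 k) by move=> [ey [_ /=]]; rewrite paramK.
  apply: (smooth_row oU) => j.
  apply: (@smooth_comp1 _ _ _ oU V _ ((fun t => derive1 x t 0 j) \o tau)) => //.
    exact: (smooth_coord oU k (@smooth_id _ _ _)).
  apply: (@smooth_comp1 _ _ _ oV O) => //.
  exact: (smooth_coord oO j sx').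
(* The parameter [s] is close to [t0] only modulo [T]; its translate [t] is the one that [tau]
   returns. *)
- move=> s [/interior_subset /(_ s erefl) [m sm] _].
  pose t := s - m%:~R * T.
  have per_m r : gamma (r + m%:~R * T) = gamma r by exact: loop_periodic.
  have st : s = t + m%:~R * T by rewrite /t subrK.
  have tK : tau (x t 0 k) = t.
    by apply: dP; rewrite -ball_normE /= distrC /t addrAC.
  have -> : e (gamma s) = x t by rewrite st per_m.
  rewrite tK st /derive1.
  rewrite [in RHS](_ : (fun h : R => _) = (fun h => h^-1 *: (x (h + t) - x t))) //.
  by apply/funext => h; rewrite /x /= addrA !per_m.
Qed.

End Periodicity.

Lemma compact_finite_cover (X : topologicalType) (f : X -> set X) :
  compact [set: X] -> (forall i, open (f i)) -> (forall i, f i i) ->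
  exists s : seq X, forall p, exists2 i, i \in s & f i p.
Proof.
move=> cX of_ fi; have [[p0 _]|X0] := pselect (exists p : X, True); last first.
  by exists [::] => p; case: X0; exists p.
pose mix := isPointed.Build X p0.
pose PX : ptopologicalType := HB.pack (Topological.sort X) mix.
have := cX; rewrite -[compact _]/(@compact PX setT) compact_cover.
case/(_ X setT f) => [i _|p _|s _ cov]; [exact: of_|by exists p|].
by exists (finmap.enum_fset s) => p; have [i /= si fip] := cov p I; exists i.
Qed.

Section PartitionOfUnity.
Context (R : realType) (n : nat) (M : smoothManifold R n).

(** The positivity sets of the bumps cover [M]; a finite subcover makes the sum of its bumps
    positive everywhere, so that one can divide by it. *)
Lemma partition_of_unity (W : M -> set M) : compact [set: M] ->
  (forall p, [/\ open (W p), W p p & W p `<=` source (chart_at p)]) ->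
  exists (s : seq M) (psi : M -> M -> R) (K : M -> set M),
    (forall i, [/\ smooth_fun (psi i), forall p, 0 <= psi i p, closed (K i),
       K i `<=` W i & forall p, ~ K i p -> psi i p = 0]) /\
    forall p, \sum_(i <- s) psi i p = 1.
Proof.
move=> cM PW.
have bump i : exists phiK : (M -> R) * set M,
    [/\ smooth_fun phiK.1, forall p, 0 <= phiK.1 p, 0 < phiK.1 i, closed phiK.2 &
        phiK.2 `<=` W i /\ forall p, ~ phiK.2 p -> phiK.1 p = 0].
  have [oW Wi _] := PW i.
  have [phi [K [s0 p0 i0 cK [KW K0]]]] :=
    exists_bump (chart_at_atlas i) (chart_at_source i) oW Wi.
  by exists (phi, K); split=> //; split=> // p /KW [].
have [phiK Pphi] := choice bump.
pose phi i := (phiK i).1; pose K i := (phiK i).2.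
have cphi i : continuous (phi i).
  move=> p; have cp := chart_at_source p.
  have tp := coords_target cp.
  have [/(_ _ (chart_at_atlas p)) sp _ _ _ _] := Pphi i.
  have cpp : {for chart_at p p, continuous (phi i \o param (chart_at p))}.
    exact: smooth_continuous sp tp.
  apply: (@near_continuous _ _ ((phi i \o param (chart_at p)) \o chart_at p)).
    apply: (near_open (@open_source _ _ _ (chart_at p)) cp) => q cq /=.
    by rewrite coordsK.
  exact: continuous_comp (coords_continuous cp) cpp.
have [i|i|s cov] := compact_finite_cover (f := fun i => phi i @^-1` [set y | 0 < y]) cM.
- by apply: open_comp => [p _|]; [exact: cphi|exact: open_gt].
- by have [] := Pphi i.
have phi0 i p : 0 <= phi i p by have [_ + _ _ _] := Pphi i; exact.
pose S p := \sum_(i <- s) phi i p.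
have S0 p : 0 < S p.
  have [i /= si phii] := cov p.
  rewrite /S (big_rem i) //=; apply: ltr_pwDl => //.
  by apply: sumr_ge0.
exists s, (fun i p => phi i p * (S p)^-1), K.
split=> [i|p]; last by rewrite -mulr_suml; exact: mulfV (lt0r_neq0 (S0 p)).
have [s1 _ _ cK [KW K0]] := Pphi i; split; [| |exact: cK|exact: KW|].
- move=> e ae; have oe := @open_target _ _ _ e.
  apply: (smoothM oe (s1 e ae)).
  apply: (@smoothV _ _ _ oe (S \o param e)).
    by move=> x _; rewrite /= gt_eqF.
  apply: (@smooth_sum _ _ _ oe _ s xpredT
    (fun i => phi i \o param e)) => j _.
  by have [/(_ _ ae)] := Pphi j.
- by move=> p; rewrite mulr_ge0 // invr_ge0 ltW.
- by move=> p nK; rewrite /phi K0 ?mul0r.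
Qed.

Lemma smooth_bumpM (e : chart R n M) (psi : M -> R) (K W : set M)
    (G : 'rV[R]_n -> R) : atlas M e ->
  smooth_fun psi -> closed K -> open W -> K `<=` W ->
  (forall p, ~ K p -> psi p = 0) ->
  smooth (target e `&` param e @^-1` W) G ->
  smooth (target e) (fun x => psi (param e x) * G x).
Proof.
move=> ae spsi cK oW KW K0 sG; apply: (smooth_zero_extension cK oW KW).
  have s1 : smooth (target e `&` param e @^-1` W) (fun x => psi (param e x)).
    by apply: smooth_sub (spsi e ae) => x [].
  exact: (smoothM (@open_chart_preimage _ _ _ e _ oW) s1 sG).
by move=> x _ nK; rewrite K0 ?mul0r.
Qed.

Lemma dchart_sum (e : chart R n M) p (I : Type) (r : seq I) (c : I -> R)
    (v : I -> 'rV[R]_n) : atlas M e -> source e p ->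
  dchart e p (\sum_(i <- r) c i *: v i) = \sum_(i <- r) c i *: dchart e p (v i).
Proof.
move=> ae ep; elim: r => [|i r IH].
  by rewrite !big_nil /dchart derive0.
by rewrite !big_cons dchart_linear // IH.
Qed.

(** [X p] is expressed in [chart_at p], which may change abruptly with [p]; smoothness is therefore
    tested on the components in a fixed chart. *)
Definition smooth_field (X : M -> 'rV[R]_n) : Prop :=
  forall e, atlas M e ->
    smooth (target e) (fun x => dchart e (param e x) (X (param e x))).

Lemma smooth_field_chart (E e : chart R n M) (W : set M) (b : 'rV[R]_n -> 'rV[R]_n) :
  atlas M E -> atlas M e -> open W -> W `<=` source E ->
  smooth (target E `&` param E @^-1` W) b ->
  smooth (target e `&` param e @^-1` W) (fun x =>
    dchart e (param e x) (coord_vector E (param e x) (b (E (param e x))))).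
Proof.
move=> aE ae oW WE sb.
have oU := @open_chart_preimage _ _ _ e _ oW.
have oU' := @open_chart_preimage _ _ _ E _ oW.
apply: (smooth_row oU) => j.
have sT := smooth_overlap aE ae.
have oT := @open_overlap _ _ _ E e.
have UT x : (target e `&` param e @^-1` W) x -> overlap E e (E (param e x)).
  by move=> [ex Wx]; apply: overlap_coords; [exact: WE|exact: param_source].
have sy : smooth (target e `&` param e @^-1` W) (E \o param e).
  by apply: smooth_sub (smooth_overlap ae aE) => x [ex /WE Ex].
(* The direction of differentiation varies with the point; expanding it in the standard basis leaves
   fixed directions with smooth coefficients. *)
apply: (@smooth_ext _ _ _ oU _ (fun x => \sum_l
   b (E (param e x)) 0 l *
   'D_(unit_row R l) (fun y => (e \o param E) y 0 j) (E (param e x)))).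
  move=> x Ux; have [ex Wx] := Ux; have EW := WE _ Wx.
  rewrite dchart_coord_vector //; last exact: param_source.
  rewrite derive_coord; last exact: smooth_derivable sT (UT _ Ux).
  by rewrite -(smooth_deriveE _ oT (UT _ Ux) (smooth_coord oT j sT)).
apply: (smooth_sum oU) => l _; apply: (smoothM oU).
  apply: (@smooth_comp _ _ _ oU _ _ (E \o param e) (fun y => b y 0 l) oU') => //.
    move=> x [ex Wx]; split; first by apply: coords_target; exact: WE.
    by rewrite /= coordsK //; exact: WE.
  exact: smooth_coord.
apply: (@smooth_comp _ _ _ oU _ _ (E \o param e)
  ('D_(unit_row R l) (fun y => (e \o param E) y 0 j)) oT) => //.
by apply: smooth_derive; exact: smooth_coord.
Qed.

(** Local fields are averaged with a partition of unity. At a loop point every field of nonzero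
    weight equals the velocity, and so does the average, the weights having sum 1. *)
Lemma velocity_extension (T : R) (gamma : R -> M) :
  compact [set: M] -> embedded_loop T gamma ->
  exists2 X : M -> 'rV[R]_n, smooth_field X &
    forall t, X (gamma t) = velocity gamma t.
Proof.
move=> cM emb; have [_ sc _ _ _] := emb.
have loc i : exists Wb : set M * ('rV[R]_n -> 'rV[R]_n),
    [/\ open Wb.1, Wb.1 i, Wb.1 `<=` source (chart_at i),
        smooth (target (chart_at i) `&` param (chart_at i) @^-1` Wb.1) Wb.2 &
        forall t, Wb.1 (gamma t) ->
          Wb.2 (chart_at i (gamma t)) = derive1 (chart_at i \o gamma) t].
  have [W [b H]] := local_velocity_field emb (chart_at_atlas i) (chart_at_source i).
  by exists (W, b).
have [Wb PWb] := choice loc.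
have [|s [psi [K [Ppsi psi1]]]] := @partition_of_unity (fun i => (Wb i).1) cM.
  by move=> i; have [oW Wi WE _ _] := PWb i; split.
pose Y i p := coord_vector (chart_at i) p ((Wb i).2 (chart_at i p)) : 'rV[R]_n.
exists (fun p => \sum_(i <- s) psi i p *: Y i p).
  move=> e ae; have oe := @open_target _ _ _ e.
  apply: (smooth_row oe) => j.
  apply: (@smooth_ext _ _ _ oe _ (fun x => \sum_(i <- s)
    psi i (param e x) * dchart e (param e x) (Y i (param e x)) 0 j)).
    move=> x ex; rewrite dchart_sum //; last exact: param_source.
    by rewrite summxE; apply: eq_bigr => i _; rewrite mxE.
  apply: (smooth_sum oe) => i _.
  have [s1 _ cK KW K0] := Ppsi i; have [oW _ WE sb _] := PWb i.
  apply: (smooth_bumpM ae s1 cK oW KW K0).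
  apply: smooth_coord; first exact: open_chart_preimage.
  exact: (smooth_field_chart (chart_at_atlas i) ae oW WE sb).
move=> t; rewrite (eq_bigr (fun i => psi i (gamma t) *: velocity gamma t)).
  by rewrite -scaler_suml psi1 scale1r.
move=> i _; have [s1 _ cK KW K0] := Ppsi i; have [oW _ WE _ bE] := PWb i.
have [Kt|nK] := pselect (K i (gamma t)); last by rewrite (K0 _ nK) !scale0r.
have Et := WE _ (KW _ Kt).
rewrite /Y (bE _ (KW _ Kt)) -(dchart_velocity sc (chart_at_atlas i) Et).
by rewrite (coord_vectorK _ (chart_at_atlas i) Et).
Qed.

(** Euclidean products of chart components, averaged with a partition of unity. *)
Lemma exists_metric : compact [set: M] -> inhabited (riemannian_metric M).
Proof.
move=> cM.
have [|s [psi [K [Ppsi psi1]]]] := @partition_of_unity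
    (fun i : M => source (chart_at i)) cM.
  by move=> i; split=> //; [exact: open_source|exact: chart_at_source].
pose q (i p : M) (v w : 'rV[R]_n) : R :=
  \sum_j dchart (chart_at i) p v 0 j * dchart (chart_at i) p w 0 j.
pose g (p : M) (v w : tangent p) : R := \sum_(i <- s) psi i p * q i p v w.
have g_linear p (c : R) (u v w : 'rV[R]_n) :
    g p (c *: u + v) w = c * g p u w + g p v w.
  rewrite /g mulr_sumr -big_split /=; apply: eq_bigr => i _.
  have [_ _ _ KW K0] := Ppsi i.
  have [/KW Ei|nK] := pselect (K i p); last first.
    have zero (a b d : R) : 0 * a = c * (0 * b) + 0 * d by ring.
    by rewrite (K0 _ nK); exact: zero.
  rewrite mulrCA -mulrDr; congr (_ * _).
  rewrite /q mulr_sumr -big_split /=; apply: eq_bigr => j _.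
  by rewrite dchart_linear ?mxE ?mulrDl ?mulrA //; exact: chart_at_atlas.
have g_sym p (v w : 'rV[R]_n) : g p v w = g p w v.
  have q_sym i : q i p v w = q i p w v by apply: eq_bigr => j _; exact: mulrC.
  exact: (eq_bigr _ (fun i _ => congr1 ( *%R (psi i p)) (q_sym i))).
have q_ge0 i p v : 0 <= q i p v v.
  by apply: sumr_ge0 => j _; rewrite -expr2 sqr_ge0.
have g_pos p (v : 'rV[R]_n) : v != 0 -> 0 < g p v v.
  move=> v0; have t0 i : 0 <= psi i p * q i p v v.
    by have [_ p0 _ _ _] := Ppsi i; rewrite mulr_ge0.
  (* If the sum were zero, so would be every summand. Since the pulled-back product is positive on
     [v] wherever [p] lies in [K i], all weights would vanish, against their sum being 1. *)
  rewrite lt_def sumr_ge0 // andbT; apply/negP; rewrite psumr_eq0 // => /allP g0.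
  have : \sum_(i <- s) psi i p = 0.
    apply: big1_seq => i /= si; have /= := g0 i si.
    have [_ _ _ KW K0] := Ppsi i.
    have [/KW Ei|/K0 -> //] := pselect (K i p).
    rewrite mulf_eq0 => /orP[/eqP //|].
    rewrite psumr_eq0 => [/allP q0|j _]; last by rewrite -expr2 sqr_ge0.
    move: v0; rewrite -(dchart_eq0 v (chart_at_atlas i) Ei) => /rV0Pn[j].
    have /= := q0 j (mem_index_enum j).
    by rewrite mulf_eq0 orbb => /eqP ->; rewrite eqxx.
  by rewrite psi1 => /eqP; rewrite oner_eq0.
have g_smooth e (ae : atlas M e) v w :
    smooth (target e) (fun x => local_metric g e x v w).
  have oe := @open_target _ _ _ e.
  apply: (smooth_sum oe) => i _.
  have [s1 _ cK KW K0] := Ppsi i; have ai := chart_at_atlas i.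
  have oS := @open_source _ _ _ (chart_at i).
  apply: (smooth_bumpM ae s1 cK oS KW K0).
  have oU := @open_chart_preimage _ _ _ e _ oS.
  have sT := smooth_overlap ae ai.
  apply: (smooth_sum oU) => j _.
  have sD u : smooth (target e `&` param e @^-1` source (chart_at i))
      (fun x => dchart (chart_at i) (param e x) (coord_vector e (param e x) u) 0 j).
    apply: (smooth_ext oU _ (smooth_coord oU j (smooth_derive u sT))) => x [ex Ex].
    by rewrite dchart_coord_vector ?paramK //; exact: param_source.
  exact: (smoothM oU (sD v) (sD w)).
exact: inhabits (RiemannianMetric g_linear g_sym g_pos g_smooth).
Qed.

End PartitionOfUnity.

(** * Local expressions of tensors *)

Section LocalTensors.
Context (R : realType) (n : nat) (M : smoothManifold R n).
Implicit Types (e : chart R n M) (g : riemannian_metric M) (a : one_form M).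
Local Notation u_ i := (unit_row R i).

Lemma linear_row_sum (f : 'rV[R]_n -> R) (v : 'rV[R]_n) :
  (forall (c : R) u w, f (c *: u + w) = c * f u + f w) ->
  f v = \sum_j v 0 j * f (u_ j).
Proof.
move=> lf; have f0 : f 0 = 0.
  have /eqP := lf 1 0 0; rewrite scaler0 addr0 mul1r.
  by rewrite -subr_eq subrr => /eqP.
rewrite {1}[v]row_sum_delta; elim: (index_enum _) => [|j r IH].
  by rewrite !big_nil.
by rewrite !big_cons lf IH.
Qed.

Lemma form0 a p : a p 0 = 0.
Proof.
have := form_linear a p 1 0 0; rewrite scaler0 addr0 mul1r => /eqP.
by rewrite -subr_eq subrr => /eqP.
Qed.

Lemma metric0l g p (w : 'rV[R]_n) : g p 0 w = 0.
Proof.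
have := metric_linear g p 1 0 0 w; rewrite scaler0 addr0 mul1r => /eqP.
by rewrite -subr_eq subrr => /eqP.
Qed.

Lemma metricZl g p (c : R) (v w : 'rV[R]_n) : g p (c *: v) w = c * g p v w.
Proof. by have := metric_linear g p c v 0 w; rewrite metric0l !addr0. Qed.

Lemma metric_linearr g p (c : R) (u v w : 'rV[R]_n) :
  g p w (c *: u + v) = c * g p w u + g p w v.
Proof. by rewrite Defs.metric_sym metric_linear !(Defs.metric_sym g _ w). Qed.

Lemma local_form_linear a e y (c : R) (u v : 'rV[R]_n) :
  atlas M e -> target e y ->
  local_form a e y (c *: u + v) = c * local_form a e y u + local_form a e y v.
Proof.
move=> ae ey; rewrite /local_form coord_vector_linear ?form_linear //.
exact: param_source.
Qed.

Lemma local_metric_linear g e y (c : R) (u v w : 'rV[R]_n) :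
  atlas M e -> target e y ->
  local_metric g e y (c *: u + v) w =
  c * local_metric g e y u w + local_metric g e y v w.
Proof.
move=> ae ey; rewrite /local_metric coord_vector_linear ?metric_linear //.
exact: param_source.
Qed.

Lemma local_metric_sym g e y (v w : 'rV[R]_n) :
  local_metric g e y v w = local_metric g e y w v.
Proof. exact: Defs.metric_sym. Qed.

Lemma local_formE a e y (v : 'rV[R]_n) : atlas M e -> target e y ->
  local_form a e y v = \sum_j v 0 j * local_form a e y (u_ j).
Proof.
by move=> ae ey; apply: linear_row_sum => c u w; exact: local_form_linear.
Qed.

Lemma local_metricE g e y (v w : 'rV[R]_n) : atlas M e -> target e y ->
  local_metric g e y v w = \sum_j v 0 j * local_metric g e y (u_ j) w.
Proof.
move=> ae ey; apply: (@linear_row_sum (fun v => local_metric g e y v w)) => c u v'.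
exact: local_metric_linear.
Qed.

Lemma local_metric_gt0 g e y (v : 'rV[R]_n) : atlas M e -> target e y ->
  v != 0 -> 0 < local_metric g e y v v.
Proof.
move=> ae ey v0; apply: metric_pos; have ep := param_source ey.
by rewrite -(dchart_eq0 _ ae ep) dchartK.
Qed.

Lemma gramE g e y (v w : 'rV[R]_n) : atlas M e -> target e y ->
  (v *m gram g e y *m w^T) 0 0 = local_metric g e y v w.
Proof.
move=> ae ey; rewrite (local_metricE g v w ae ey) -mulmxA mxE.
apply: eq_bigr => a _; congr (_ * _).
rewrite local_metric_sym (local_metricE g w (u_ a) ae ey) mxE.
apply: eq_bigr => b _; rewrite !mxE mulrC; congr (_ * _).
exact: local_metric_sym.
Qed.

Lemma gram_unit g e y : atlas M e -> target e y -> gram g e y \in unitmx.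
Proof.
move=> ae ey; rewrite unitmxE unitfE; apply/negP => /det0P[v v0 vG].
have := local_metric_gt0 g ae ey v0.
by rewrite -(gramE g v v ae ey) vG mul0mx mxE ltxx.
Qed.

Lemma gram_sym g e y : (gram g e y)^T = gram g e y.
Proof. by apply/matrixP => a b; rewrite !mxE; exact: local_metric_sym. Qed.

Lemma derive_lincomb (I : finType) (V : normedModType R) (U : set V) (c : I -> R)
    (F : I -> V -> R) (f : V -> R) x v : open U -> U x ->
  (forall i, smooth U (F i)) ->
  (forall y, U y -> f y = \sum_i c i * F i y) ->
  'D_v f x = \sum_i c i * 'D_v (F i) x.
Proof.
move=> oU Ux sF fE.
rewrite (@near_eq_derive _ _ _ _ (fun y => \sum_i c i * F i y)); last first.
  exact: (near_open oU Ux fE).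
elim: (index_enum I) => [|i r IH].
  rewrite big_nil (_ : (fun y => _) = fun=> 0) ?derive_cst //.
  by apply/funext => y; rewrite big_nil.
have s1 j : smooth U (fun y => c j * F j y).
  by apply: (smoothM oU _ (sF j)); exact: smooth_cst.
rewrite (_ : (fun y => _) =
    (fun y => c i * F i y) + (fun y => \sum_(j <- r) c j * F j y)); last first.
  by apply/funext => y; rewrite big_cons.
rewrite deriveD; last 2 first.
- exact: smooth_derivable (s1 i) Ux.
- have s2 := @smooth_sum _ _ _ oU _ r xpredT _ (fun j _ => s1 j).
  exact: smooth_derivable s2 Ux.
rewrite big_cons IH; congr (_ + _).
by have := @deriveZ _ _ _ (F i) (c i) x v (smooth_derivable (sF i) Ux).
Qed.

Lemma derive_local_metricl g e x (v w z : 'rV[R]_n) : atlas M e -> target e x ->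
  'D_z (fun y => local_metric g e y v w) x =
  \sum_j v 0 j * 'D_z (fun y => local_metric g e y (u_ j) w) x.
Proof.
move=> ae ex.
apply: (@derive_lincomb _ _ _ (fun j => v 0 j)
  (fun j y => local_metric g e y (u_ j) w) _ x z (@open_target _ _ _ e) ex).
  by move=> j; exact: metric_smooth.
by move=> y ey; exact: local_metricE.
Qed.

Lemma derive_local_form a e x (v z : 'rV[R]_n) : atlas M e -> target e x ->
  'D_z (fun y => local_form a e y v) x =
  \sum_j v 0 j * 'D_z (fun y => local_form a e y (u_ j)) x.
Proof.
move=> ae ex.
apply: (@derive_lincomb _ _ _ (fun j => v 0 j)
  (fun j y => local_form a e y (u_ j)) _ x z (@open_target _ _ _ e) ex).
  by move=> j; exact: form_smooth.
by move=> y ey; exact: local_formE.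
Qed.

Lemma derive_mul (V : normedModType R) (f h : V -> R) x v :
  derivable f x v -> derivable h x v ->
  'D_v (fun y => f y * h y) x = 'D_v f x * h x + f x * 'D_v h x.
Proof.
by move=> df dh; rewrite [LHS](deriveM df dh) addrC [X in X + _ = _]mulrC.
Qed.

Lemma local_form_trans a e f p (w : 'rV[R]_n) : atlas M e -> atlas M f ->
  source e p -> source f p ->
  local_form a e (e p) w = local_form a f (f p) ('D_w (f \o param e) (e p)).
Proof.
move=> ae af ep fp.
by rewrite /local_form (coordsK ep) (coordsK fp) (coord_vector_trans w ae af ep fp).
Qed.

(* The second derivatives of the transition map cancel by symmetry. *)
Lemma dform_chart a e p (v w : 'rV[R]_n) : atlas M e -> source e p ->
  'D_v (fun y => local_form a e y w) (e p)
  - 'D_w (fun y => local_form a e y v) (e p)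
  = dform a (coord_vector e p v) (coord_vector e p w).
Proof.
move=> ae ep; set E := chart_at p; have aE : atlas M E := chart_at_atlas p.
have Ep : source E p := chart_at_source p.
pose Phi := E \o param e; set x := e p.
have oO := @open_overlap _ _ _ e E; have oT := @open_target _ _ _ E.
have Ox : overlap e E x := overlap_coords ep Ep.
have sP : smooth (overlap e E) Phi := smooth_overlap ae aE.
have Phix : Phi x = E p by rewrite /Phi /= coordsK.
pose A j y := local_form a E y (u_ j).
have sA j : smooth (target E) (A j) by exact: form_smooth.
have OT y : overlap e E y -> target E (Phi y) by move=> [_ Ey]; exact: coords_target.
have sPj j : smooth (overlap e E) (fun y => Phi y 0 j) by exact: smooth_coord.
pose S v w := \sum_j 'D_v ('D_w (fun y => Phi y 0 j)) x * A j (Phi x).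
(* Product and chain rule: [S] collects the second derivatives of the transition map, and the
   remainder is the derivative in [chart_at p] with the transformed vectors frozen. *)
have D v' w' : 'D_v' (fun y => local_form a e y w') x =
    S v' w' + 'D_('D_v' Phi x) (fun y => local_form a E y ('D_w' Phi x)) (Phi x).
  rewrite (derive_local_form a _ _ aE (OT _ Ox)).
  pose F j y := 'D_w' (fun z => Phi z 0 j) y * A j (Phi y).
  have sF1 j : smooth (overlap e E) ('D_w' (fun z => Phi z 0 j)).
    exact: smooth_derive.
  have sF2 j : smooth (overlap e E) (A j \o Phi).
    exact: (smooth_comp oO oT OT sP (sA j)).
  have sF j : smooth (overlap e E) (F j) by exact: (smoothM oO (sF1 j) (sF2 j)).
  rewrite (@derive_lincomb _ _ _ (fun=> 1) F _ x v' oO Ox sF); last first.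
    move=> y Oy; have [ey Ey] := Oy.
    have -> : local_form a e y w' = local_form a E (Phi y) ('D_w' Phi y).
      have := local_form_trans a w' ae aE (param_source ey) Ey.
      by rewrite (paramK ey).
    rewrite (local_formE a _ aE (OT _ Oy)); apply: eq_bigr => j _.
    by rewrite mul1r /F (derive_coord _ (smooth_derivable sP Oy)).
  rewrite /S -big_split /=; apply: eq_bigr => j _; rewrite mul1r.
  have d1 := smooth_derivable (v := v') (sF1 j) Ox.
  have d2 := smooth_derivable (v := v') (sF2 j) Ox.
  apply: (etrans (derive_mul d1 d2)).
  have [_ dAP] := is_derive_comp_smooth oT (OT _ Ox) (sA j)
    (smooth_continuous sP Ox) (smooth_derivable (v := v') sP Ox).
  have dP := esym (derive_coord j (smooth_derivable (v := w') sP Ox)).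
  exact: (congr2 +%R erefl (congr2 *%R dP dAP)).
rewrite !D /dform -/E -Phix.
have -> : S v w = S w v.
  by apply: eq_bigr => j _; rewrite (derive_comm v w oO Ox (sPj j 2%N)).
by rewrite opprD addrACA subrr add0r.
Qed.

End LocalTensors.

(** * Geodesics and calibrations *)

(** Contracted with the symmetric [v a * v b], the first two terms of a Christoffel symbol coincide,
    so their sum absorbs the factor 1/2. *)
Lemma contraction_sum (R : realFieldType) n (G v : 'I_n -> R)
    (d : 'I_n -> 'I_n -> 'I_n -> R) :
  \sum_a \sum_b
    2^-1 * (\sum_l G l * (d a b l + d b a l - d l a b)) * v a * v b =
  \sum_l G l * (\sum_a \sum_b v a * v b * d a b l
                - 2^-1 * \sum_a \sum_b v a * v b * d l a b).
Proof.
have sym l : \sum_a \sum_b v a * v b * d a b l = \sum_a \sum_b v a * v b * d b a l.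
  rewrite exchange_big /=; apply: eq_bigr => a _; apply: eq_bigr => b _.
  by rewrite [v b * _]mulrC.
transitivity (\sum_l \sum_a \sum_b
    G l * (2^-1 * (v a * v b * d a b l + v a * v b * d b a l - v a * v b * d l a b))).
  rewrite [RHS]exchange_big /=; apply: eq_bigr => a _.
  rewrite [RHS]exchange_big /=; apply: eq_bigr => b _.
  by rewrite mulr_sumr !mulr_suml; apply: eq_bigr => l _; ring.
apply: eq_bigr => l _.
under eq_bigr => a _ do rewrite -mulr_sumr -mulr_sumr sumrB big_split /=.
by rewrite -mulr_sumr -mulr_sumr sumrB big_split /= -sym; field.
Qed.

Section EulerLagrange.
Context (R : realType) (n : nat) (M : smoothManifold R n).
Implicit Types (e : chart R n M) (g : riemannian_metric M) (a : one_form M).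
Local Notation u_ i := (unit_row R i).

(** The expanded form of d/dt g(x', u_l) = 1/2 D_(u_l) g(x', x') for position [x], velocity [dx] and
    acceleration [ddx], with the vectors frozen inside the spatial derivatives. No inverse of the
    Gram matrix appears. *)
Definition euler_lagrange g e (x dx ddx : 'rV[R]_n) : Prop :=
  forall l, 'D_dx (fun y => local_metric g e y dx (u_ l)) x
    + local_metric g e x ddx (u_ l)
    = 2^-1 * 'D_(u_ l) (fun y => local_metric g e y dx dx) x.

Lemma christoffel_contraction g e k (x dx : 'rV[R]_n) : atlas M e -> target e x ->
  \sum_(a < n) \sum_(b < n) christoffel g e k a b x * dx 0 a * dx 0 b =
  \sum_(l < n) invmx (gram g e x) k l *
    ('D_dx (fun y => local_metric g e y dx (u_ l)) x
     - 2^-1 * 'D_(u_ l) (fun y => local_metric g e y dx dx) x).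
Proof.
move=> ae ex; have oe := @open_target _ _ _ e.
pose G i j y := local_metric g e y (u_ i) (u_ j).
have sG i j : smooth (target e) (G i j) by exact: metric_smooth.
have gramG i j : (fun y => gram g e y i j) = G i j.
  by apply/funext => y; rewrite mxE.
pose d i j l := 'D_(u_ i) (G j l) x.
have E1 l : 'D_dx (fun y => local_metric g e y dx (u_ l)) x =
    \sum_a \sum_b dx 0 a * dx 0 b * d a b l.
  rewrite derive_local_metricl // exchange_big /=; apply: eq_bigr => b _.
  rewrite (smooth_deriveE dx oe ex (sG b l)) mulr_sumr; apply: eq_bigr => a _.
  by rewrite mulrCA mulrA.
have E2 l : 'D_(u_ l) (fun y => local_metric g e y dx dx) x =
    \sum_a \sum_b dx 0 a * dx 0 b * d l a b.
  rewrite derive_local_metricl //; apply: eq_bigr => a _.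
  under [in LHS]eq_fun do rewrite local_metric_sym.
  rewrite derive_local_metricl // mulr_sumr; apply: eq_bigr => b _.
  under [in LHS]eq_fun do rewrite local_metric_sym.
  exact: mulrA.
transitivity (\sum_l invmx (gram g e x) k l *
    (\sum_a \sum_b dx 0 a * dx 0 b * d a b l
     - 2^-1 * \sum_a \sum_b dx 0 a * dx 0 b * d l a b)); last first.
  by apply: eq_bigr => l _; rewrite E1 E2.
rewrite -contraction_sum; apply: eq_bigr => a _; apply: eq_bigr => b _.
congr (_ * _ * _); rewrite /christoffel; congr (_ * _).
by apply: eq_bigr => l _; rewrite !gramG.
Qed.

(** Lowering the index: the two systems differ by multiplication with the Gram matrix, which is
    invertible. *)
Lemma geodesic_euler_lagrange g e (x dx ddx : 'rV[R]_n) : atlas M e -> target e x ->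
  (forall k, ddx 0 k + \sum_(a < n) \sum_(b < n)
        christoffel g e k a b x * dx 0 a * dx 0 b = 0) <->
  euler_lagrange g e x dx ddx.
Proof.
move=> ae ex.
pose c : 'rV[R]_n := \row_l ('D_dx (fun y => local_metric g e y dx (u_ l)) x
     - 2^-1 * 'D_(u_ l) (fun y => local_metric g e y dx dx) x).
have cE k : \sum_(a < n) \sum_(b < n) christoffel g e k a b x * dx 0 a * dx 0 b =
    (c *m invmx (gram g e x)) 0 k.
  rewrite christoffel_contraction // mxE; apply: eq_bigr => l _.
  by rewrite mxE mulrC -{1}gram_sym -trmx_inv mxE.
have mE l : local_metric g e x ddx (u_ l) = (ddx *m gram g e x) 0 l.
  by rewrite (local_metricE g ddx (u_ l) ae ex) mxE; apply: eq_bigr => j _; rewrite mxE.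
have uG := gram_unit g ae ex.
have EL : euler_lagrange g e x dx ddx <-> ddx *m gram g e x + c = 0.
  split=> [H|H l].
    apply/rowP => l; rewrite mxE -mE [c 0 l]mxE mxE -(H l).
    have key (p q : R) : q + (p - (p + q)) = 0 by ring.
    exact: key.
  have /rowP/(_ l) := H; rewrite mxE -mE [c 0 l]mxE mxE.
  have key (p q r : R) : q + (p - r) = 0 -> p + q = r.
    by rewrite addrCA addrA => /eqP; rewrite subr_eq0 => /eqP.
  exact: key.
rewrite EL; split=> [H|H k].
  have -> : c = - (ddx *m gram g e x).
    have : ddx = - (c *m invmx (gram g e x)).
      by apply/rowP => k; rewrite mxE; apply/eqP; rewrite -addr_eq0 -cE H.
    by move=> ->; rewrite mulNmx mulmxKV // opprK.
  exact: subrr.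
have : ddx = - (c *m invmx (gram g e x)).
  have -> : c = - (ddx *m gram g e x).
    by apply/eqP; rewrite -addr_eq0 addrC H.
  by rewrite mulNmx mulmxK // opprK.
by move=> /rowP/(_ k); rewrite mxE cE => ->; rewrite addNr.
Qed.

End EulerLagrange.

(** * Derivatives along a curve *)

Section AlongCurve.
Context (R : realType) (n : nat) (M : smoothManifold R n).
Local Notation u_ i := (unit_row R i).

Lemma is_derive_sum_fun (V : normedModType R) m (h : 'I_m -> V -> R)
    (dh : 'I_m -> R) x v :
  (forall i, is_derive x v (h i) (dh i)) ->
  is_derive x v (fun y => \sum_i h i y) (\sum_i dh i).
Proof.
move=> Dh; rewrite (_ : (fun y => _) = \sum_i h i); first exact: is_derive_sum.
by apply/funext => y; rewrite fct_sumE.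
Qed.

Lemma is_derive_mul (V : normedModType R) (f h : V -> R) x v (df dh : R) :
  is_derive x v f df -> is_derive x v h dh ->
  is_derive x v (fun y => f y * h y) (df * h x + f x * dh).
Proof.
move=> [df1 <-] [dh1 <-]; split; [exact: (derivableM df1 dh1)|exact: (derive_mul df1 dh1)].
Qed.

Lemma derive_local_metricr (g : riemannian_metric M) (e : chart R n M) x
    (v w z : 'rV[R]_n) : atlas M e -> target e x ->
  'D_z (fun y => local_metric g e y v w) x =
  \sum_j w 0 j * 'D_z (fun y => local_metric g e y v (u_ j)) x.
Proof.
move=> ae ex.
have sym u u' : (fun y => local_metric g e y u u') = (fun y => local_metric g e y u' u).
  by apply/funext => y; exact: local_metric_sym.
rewrite sym (derive_local_metricl g _ _ _ ae ex); apply: eq_bigr => j _.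
by rewrite sym.
Qed.

Variables (gamma : R -> M) (sc : smooth_curve gamma).
Variables (e : chart R n M) (ae : atlas M e).
Let x := e \o gamma.
Let dx := derive1 x.
Let O := gamma @^-1` source e.

Let oO : open O.
Proof. by apply: open_comp; [move=> s _; case: sc => + _; exact|exact: open_source]. Qed.

Let sx : smooth O x. Proof. by case: sc => _; exact. Qed.

Let xT s : O s -> target e (x s). Proof. exact: coords_target. Qed.

Let dxE s : dx s = 'D_1 x s. Proof. exact: derive1E. Qed.

Let sdx : smooth O dx.
Proof.
rewrite (_ : dx = 'D_1 x); last by apply/funext => s; exact: dxE.
exact: smooth_derive.
Qed.

Lemma is_derive_along (F : 'rV[R]_n -> R) t : O t -> smooth (target e) F ->
  is_derive t 1 (fun s => F (x s)) ('D_(dx t) F (x t)).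
Proof.
move=> Ot sF; rewrite dxE.
have d1 : derivable x t 1 := smooth_derivable sx Ot.
have H := is_derive_comp_smooth (@open_target _ _ _ e) (xT Ot) sF
  (smooth_continuous sx Ot) d1.
exact H.
Qed.

Lemma is_derive_velocity_coord t j : O t ->
  is_derive t 1 (fun s => dx s 0 j) (derive1 dx t 0 j).
Proof.
move=> Ot; have dd : derivable dx t 1 := smooth_derivable sdx Ot.
rewrite derive1E (derive_coord j dd); split=> //.
exact: smooth_derivable (smooth_coord oO j sdx) Ot.
Qed.

(** For a basis vector [w] the value is the left-hand side of [euler_lagrange], which thereby
    becomes the rate of change of a momentum. *)
Lemma is_derive_momentum (g : riemannian_metric M) (w : 'rV[R]_n) t : O t ->
  is_derive t 1 (fun s => local_metric g e (x s) (dx s) w)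
    ('D_(dx t) (fun y => local_metric g e y (dx t) w) (x t)
     + local_metric g e (x t) (derive1 dx t) w).
Proof.
move=> Ot; pose G j y := local_metric g e y (u_ j) w.
apply: (@near_eq_is_derive _ _ _ (fun s => \sum_j dx s 0 j * G j (x s))).
  apply: (near_open oO Ot) => s Os; apply: esym.
  exact: local_metricE (xT Os).
have D j : is_derive t 1 (fun s => dx s 0 j * G j (x s))
    (derive1 dx t 0 j * G j (x t) + dx t 0 j * 'D_(dx t) (G j) (x t)).
  apply: is_derive_mul; first exact: is_derive_velocity_coord.
  by apply: is_derive_along => //; exact: metric_smooth.
apply: is_derive_eq (is_derive_sum_fun D) _.
rewrite big_split /= addrC; congr (_ + _).
  by rewrite (derive_local_metricl g _ _ _ ae (xT Ot)).
by rewrite (local_metricE g _ w ae (xT Ot)).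
Qed.

Lemma local_speed (g : riemannian_metric M) s (w : 'rV[R]_n) : O s ->
  local_metric g e (x s) (dx s) w =
  g (gamma s) (velocity gamma s) (coord_vector e (gamma s) w).
Proof.
move=> Os; rewrite /local_metric (coordsK Os).
have <- : dchart e (gamma s) (velocity gamma s) = dx s := dchart_velocity sc ae Os.
by rewrite (coord_vectorK _ ae Os).
Qed.

Lemma local_speed2 (g : riemannian_metric M) s : O s ->
  local_metric g e (x s) (dx s) (dx s) =
  g (gamma s) (velocity gamma s) (velocity gamma s).
Proof.
move=> Os; rewrite (local_speed _ _ Os).
have <- : dchart e (gamma s) (velocity gamma s) = dx s := dchart_velocity sc ae Os.
by rewrite (coord_vectorK _ ae Os).
Qed.

(** Conservation of energy. With Q = D_x' g(x', x'), contracting the equation with x' gives Q +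
    g(x'', x') = Q/2, while the derivative of g(x', x') is g(x'', x') + Q/2, hence zero. *)
Lemma is_derive_speed (g : riemannian_metric M) t : O t ->
  euler_lagrange g e (x t) (dx t) (derive1 dx t) ->
  is_derive t 1 (fun s => g (gamma s) (velocity gamma s) (velocity gamma s)) 0.
Proof.
move=> Ot EL; pose P j s := local_metric g e (x s) (dx s) (u_ j).
apply: (@near_eq_is_derive _ _ _ (fun s => \sum_j dx s 0 j * P j s)).
  apply: (near_open oO Ot) => s Os; rewrite -local_speed2 //.
  rewrite (local_metricE g (dx s) (dx s) ae (xT Os)).
  by apply: eq_bigr => j _; rewrite /P local_metric_sym.
have D j : is_derive t 1 (fun s => dx s 0 j * P j s)
    (derive1 dx t 0 j * P j t + dx t 0 j *
       ('D_(dx t) (fun y => local_metric g e y (dx t) (u_ j)) (x t)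
        + local_metric g e (x t) (derive1 dx t) (u_ j))).
  by apply: is_derive_mul; [exact: is_derive_velocity_coord|exact: is_derive_momentum].
apply: is_derive_eq (is_derive_sum_fun D) _; rewrite big_split /=.
pose ddx := derive1 dx t; pose lm := local_metric g e (x t).
pose Q := 'D_(dx t) (fun y => local_metric g e y (dx t) (dx t)) (x t).
have E1 : \sum_j ddx 0 j * P j t = lm ddx (dx t).
  rewrite /lm (local_metricE g ddx _ ae (xT Ot)).
  by apply: eq_bigr => j _; rewrite /P local_metric_sym.
have E2 : \sum_j dx t 0 j *
       ('D_(dx t) (fun y => local_metric g e y (dx t) (u_ j)) (x t)
        + local_metric g e (x t) ddx (u_ j)) = 2^-1 * Q.
  rewrite /Q (smooth_deriveE _ (@open_target _ _ _ e) (xT Ot) (metric_smooth g ae _ _)).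
  by rewrite mulr_sumr; apply: eq_bigr => j _; rewrite EL mulrCA.
have E3 : \sum_j dx t 0 j *
       ('D_(dx t) (fun y => local_metric g e y (dx t) (u_ j)) (x t)
        + local_metric g e (x t) ddx (u_ j)) = Q + lm ddx (dx t).
  under eq_bigr do rewrite mulrDr.
  rewrite big_split /=; congr (_ + _).
    by rewrite /Q (derive_local_metricr g _ _ _ ae (xT Ot)).
  rewrite /lm local_metric_sym (local_metricE g _ _ ae (xT Ot)).
  by apply: eq_bigr => j _; congr (_ * _); exact: local_metric_sym.
have key (q l : R) : 2^-1 * q = q + l -> l + 2^-1 * q = 0 by lra.
by rewrite E1 E2; apply: key; rewrite -E2 E3.
Qed.

End AlongCurve.

Lemma derive_at_min (R : realType) (V : normedModType R) (U : set V) (f : V -> R) x v :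
  open U -> U x -> smooth U f -> (forall y, U y -> f x <= f y) -> 'D_v f x = 0.
Proof.
move=> oU Ux sf fmin.
have ln (s : R) : {for s, continuous (fun r : R => x + r *: v)}.
  by apply: continuousD; [exact: cst_continuous|exact: scalel_continuous].
have [d /= d0 dP] : exists2 d : R, 0 < d & ball (0 : R) d `<=` [set s | U (x + s *: v)].
  apply/nbhs_ballP; apply: ln; rewrite scale0r addr0; exact: open_nbhs_nbhs.
have inU s : s \in `]- d, d[ -> U (x + s *: v).
  move=> sd; apply: dP; rewrite -ball_normE /= sub0r normrN ltr_norml.
  by move: sd; rewrite in_itv.
have Dl s : s \in `]- d, d[ ->
    is_derive s 1 (fun r => f (x + r *: v)) ('D_v f (x + s *: v)).
  by move=> /inU Us; apply: is_derive_line; exact: smooth_derivable sf Us.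
have d00 : 0 \in `]- d, d[ by rewrite in_itv /= oppr_lt0 d0.
have [] : is_derive (0 : R) 1 (fun r : R => f (x + r *: v)) 0.
  apply: (@derive1_at_min _ _ (- d) d) => //.
  - by rewrite ge0_cp // ltW.
  - by move=> s /Dl [].
  - by move=> s /inU Us; rewrite scale0r addr0; exact: fmin.
by move=> _; have [_ ->] := Dl 0 d00; rewrite scale0r addr0.
Qed.

Section Calibration.
Context (R : realType) (n : nat) (M : smoothManifold R n).
Variables (g : riemannian_metric M) (a : one_form M) (C : R) (C0 : 0 < C).
Hypothesis aC : forall p (v : 'rV[R]_n), a p v ^+ 2 <= C * g p v v.
Local Notation u_ i := (unit_row R i).

(** At the minimum, [C * G - A * A] has derivative C G' - 2 A A' = 0; since A = C there, dividing by
    2C gives G'/2 = A'. *)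
Lemma calibration_derive (e : chart R n M) (x X w : 'rV[R]_n) :
  atlas M e -> target e x ->
  local_metric g e x X X = C -> local_form a e x X = C ->
  2^-1 * 'D_w (fun y => local_metric g e y X X) x =
  'D_w (fun y => local_form a e y X) x.
Proof.
move=> ae ex gX aX; have oe := @open_target _ _ _ e.
pose G y := local_metric g e y X X; pose A y := local_form a e y X.
have sG : smooth (target e) G by exact: metric_smooth.
have sA : smooth (target e) A by exact: form_smooth.
have s1 : smooth (target e) (fun y => C * G y).
  by apply: (smoothM oe _ sG); exact: smooth_cst.
have s2 := smoothN oe (smoothM oe sA sA).
have := derive_at_min w oe ex (smoothD oe s1 s2).
have [dG dA] : derivable G x w /\ derivable A x w.
  by split; [exact: smooth_derivable sG ex|exact: smooth_derivable sA ex].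
have [_ ->] : is_derive x w (fun y => C * G y + - (A y * A y))
    (C * 'D_w G x - ('D_w A x * A x + A x * 'D_w A x)).
  apply: is_deriveB; last by apply: is_derive_mul; exact: derivableP.
  have := is_derive_mul (@is_derive_cst _ _ _ C x w) (derivableP dG).
  by rewrite mul0r add0r.
have -> : A x = C by [].
have -> : G x = C by [].
rewrite subrr => H; have {H} : C * 'D_w G x - ('D_w A x * C + C * 'D_w A x) = 0.
  apply: H => y ey; rewrite subr_ge0 -expr2; exact: aC.
move: ('D_w G x) ('D_w A x) => p q pq.
apply: (mulfI (lt0r_neq0 C0)); lra.
Qed.

Variables (gamma : R -> M) (sc : smooth_curve gamma).
Hypothesis ga : forall t (v : tangent (gamma t)),
  g (gamma t) (velocity gamma t) v = a (gamma t) v.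
Hypothesis speed : forall t, g (gamma t) (velocity gamma t) (velocity gamma t) = C.

(** The identity g(X, .) = α is known along the curve only, so it is differentiated only in t, which
    handles the momentum. Derivatives transverse to the curve are supplied by the inequality,
    through [calibration_derive]. *)
Lemma calibrated_euler_lagrange (e : chart R n M) t : atlas M e ->
  source e (gamma t) ->
  let x := e \o gamma in let dx := derive1 x in
  euler_lagrange g e (x t) (dx t) (derive1 dx t) <->
  forall l, 'D_(dx t) (fun y => local_form a e y (u_ l)) (x t) =
            'D_(u_ l) (fun y => local_form a e y (dx t)) (x t).
Proof.
move=> ae et x dx; have ex : target e (x t) by exact: coords_target.
have oO : open (gamma @^-1` source e).
  by apply: open_comp; [move=> s _; case: sc => + _; exact|exact: open_source].
have mom l : 'D_(dx t) (fun y => local_metric g e y (dx t) (u_ l)) (x t)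
     + local_metric g e (x t) (derive1 dx t) (u_ l) =
     'D_(dx t) (fun y => local_form a e y (u_ l)) (x t).
  have [_ <-] := is_derive_momentum sc ae g (u_ l) et.
  have [_ <-] := is_derive_along sc ae et (form_smooth a ae (u_ l)).
  apply: near_eq_derive; apply: (near_open oO et) => s es.
  by rewrite (local_speed sc ae) // ga /local_form (coordsK es).
have gC : local_metric g e (x t) (dx t) (dx t) = C by rewrite local_speed2.
have aX : local_form a e (x t) (dx t) = C.
  rewrite -(speed t) ga /local_form /x /= (coordsK et).
  have <- : dchart e (gamma t) (velocity gamma t) = dx t := dchart_velocity sc ae et.
  by rewrite (coord_vectorK _ ae et).
have cal l := calibration_derive (u_ l) ae ex gC aX.
by split=> H l; [rewrite -mom H cal|rewrite mom H cal].
Qed.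

End Calibration.

Section StrongGeodesicType.
Context (R : realType) (n : nat) (M : smoothManifold R n).
Implicit Types (e : chart R n M) (g : riemannian_metric M) (a : one_form M).
Local Notation u_ i := (unit_row R i).

Lemma dform_velocity_row a (gamma : R -> M) t : smooth_curve gamma ->
  let E := chart_at (gamma t) in let x := E \o gamma in
  (forall l, 'D_(derive1 x t) (fun y => local_form a E y (u_ l)) (x t) =
             'D_(u_ l) (fun y => local_form a E y (derive1 x t)) (x t)) ->
  ker_dform a (velocity gamma t).
Proof.
move=> sc E x H w; have aE : atlas M E := chart_at_atlas _.
have Ex : target E (x t) := coords_target (chart_at_source _).
rewrite /dform -/E -[velocity gamma t]/(derive1 x t) -[E (gamma t)]/(x t).
rewrite (derive_local_form a _ _ aE Ex).
rewrite (smooth_deriveE w (@open_target _ _ _ E) Ex (form_smooth a aE _)).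
apply/eqP; rewrite subr_eq0; apply/eqP; apply: eq_bigr => l _.
exact: (congr1 ( *%R (w 0 l)) (H l)).
Qed.

(** The geodesic equation is demanded in every chart of the atlas, whereas [dform] is computed in
    [chart_at]; the invariance [dform_chart] bridges the two. *)
Lemma ker_dform_chart a (gamma : R -> M) t e : smooth_curve gamma ->
  atlas M e -> source e (gamma t) -> ker_dform a (velocity gamma t) ->
  let x := e \o gamma in
  forall l, 'D_(derive1 x t) (fun y => local_form a e y (u_ l)) (x t) =
            'D_(u_ l) (fun y => local_form a e y (derive1 x t)) (x t).
Proof.
move=> sc ae et ker x l; apply/eqP; rewrite -subr_eq0; apply/eqP.
apply: (etrans (dform_chart a (derive1 x t) (u_ l) ae et)).
have -> : derive1 x t = dchart e (gamma t) (velocity gamma t).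
  by rewrite (dchart_velocity sc ae et).
by rewrite (coord_vectorK _ ae et); exact: ker.
Qed.

(** The number sqrt C bounds the form on every unit ball, and at [q] it is attained by v / sqrt
    C. *)
Lemma conorm_calibrated g a C p q (v : 'rV[R]_n) : 0 < C ->
  (forall p' (w : 'rV[R]_n), a p' w ^+ 2 <= C * g p' w w) ->
  g q v v = C -> a q v = C -> conorm g a p <= conorm g a q.
Proof.
move=> C0 aC gv av.
have sq0 : 0 < Num.sqrt C by rewrite sqrtr_gt0.
have sqC : Num.sqrt C * Num.sqrt C = C by rewrite -expr2 sqr_sqrtr // ltW.
have bnd p' : ubound [set `|a p' w| | w in [set w : tangent p' | g p' w w <= 1]]
    (Num.sqrt C).
  move=> _ [w /= gw <-]; rewrite -sqrtr_sqr ler_sqrt ?(ltW C0) //.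
  by apply: le_trans (aC _ _) _; rewrite ger_pMr.
apply: (@le_trans _ _ (Num.sqrt C)).
  apply: ge_sup; last exact: bnd.
  (* The zero vector shows that the set is nonempty, as bounding its [sup] requires. *)
  by exists `|a p 0|, 0 => //=; rewrite metric0l ler01.
apply: ub_le_sup; first by exists (Num.sqrt C); exact: bnd.
exists ((Num.sqrt C)^-1 *: v) => /=.
  rewrite metricZl Defs.metric_sym metricZl gv.
  move: (Num.sqrt C) sq0 sqC => s s0 <-.
  by rewrite mulKf ?mulVf // lt0r_neq0.
have := form_linear a q (Num.sqrt C)^-1 v 0; rewrite form0 !addr0 av => ->.
rewrite gtr0_norm; last by rewrite mulr_gt0 // invr_gt0.
by move: (Num.sqrt C) sq0 sqC => s s0 <-; rewrite mulKf // lt0r_neq0.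
Qed.

Lemma loop_pos g (T : R) (gamma : R -> M) t : embedded_loop T gamma ->
  0 < g (gamma t) (velocity gamma t) (velocity gamma t).
Proof. by move=> [_ _ v0 _ _]; apply: metric_pos; exact: v0. Qed.

Lemma geodesic_constant_speed g (gamma : R -> M) t : geodesic g gamma ->
  g (gamma t) (velocity gamma t) (velocity gamma t) =
  g (gamma 0) (velocity gamma 0) (velocity gamma 0).
Proof.
move=> [sc geo].
pose S s := g (gamma s) (velocity gamma s) (velocity gamma s).
apply: (@is_derive_0_is_cst R S) => s.
have aE := chart_at_atlas (gamma s); have Es := chart_at_source (gamma s).
apply: (is_derive_speed sc aE Es).
apply/(geodesic_euler_lagrange _ _ _ aE (coords_target Es)) => k.
exact: geo.
Qed.

Lemma calibrated_geodesic g a C (gamma : R -> M) : 0 < C ->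
  (forall p (v : 'rV[R]_n), a p v ^+ 2 <= C * g p v v) -> smooth_curve gamma ->
  (forall t (v : tangent (gamma t)),
     g (gamma t) (velocity gamma t) v = a (gamma t) v) ->
  (forall t, g (gamma t) (velocity gamma t) (velocity gamma t) = C) ->
  geodesic g gamma <-> forall t, ker_dform a (velocity gamma t).
Proof.
move=> C0 aC sc ga speed; split=> [[_ geo] t|ker].
  have aE := chart_at_atlas (gamma t); have Et := chart_at_source (gamma t).
  apply: (dform_velocity_row sc).
  apply/(calibrated_euler_lagrange C0 aC sc ga speed aE Et).
  apply/(geodesic_euler_lagrange _ _ _ aE (coords_target Et)) => k.
  exact: geo (chart_at _) aE t Et k.
split; [exact: sc|move=> e ae t et k x dx; move: k].
apply/(geodesic_euler_lagrange g (dx t) _ ae (coords_target et)).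
apply/(calibrated_euler_lagrange C0 aC sc ga speed ae et).
exact: ker_dform_chart sc ae et (ker t).
Qed.

(** The disjunction lets one lemma serve both statements: the first supplies the geodesic, the
    second the kernel condition, and [calibrated_geodesic] gives the other. *)
Lemma calibrated_strong g a C (T : R) (gamma : R -> M) : 0 < C ->
  embedded_loop T gamma -> coorientable T gamma -> null_homologous T gamma ->
  (forall p (v : 'rV[R]_n), a p v ^+ 2 <= C * g p v v) ->
  (forall t (v : tangent (gamma t)),
     g (gamma t) (velocity gamma t) v = a (gamma t) v) ->
  (forall t, g (gamma t) (velocity gamma t) (velocity gamma t) = C) ->
  geodesic g gamma \/ (forall t, ker_dform a (velocity gamma t)) ->
  strong_magnetic_geodesic g a T gamma.
Proof.
move=> C0 emb co nh aC ga speed gk; have [_ sc _ _ _] := emb.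
have eqv := calibrated_geodesic C0 aC sc ga speed.
have [geo ker] : geodesic g gamma /\ forall t, ker_dform a (velocity gamma t).
  by case: gk => H; split; first [exact: H|exact: (eqv.1 H)|exact: (eqv.2 H)].
split; [exact: emb|by split|exact: geo|exact: ker|split; last exact: ga].
move=> t p.
apply: (conorm_calibrated p C0 aC (speed t)).
by rewrite -ga speed.
Qed.

Lemma local_form_field a e y (X : M -> 'rV[R]_n) : atlas M e -> target e y ->
  a (param e y) (X (param e y)) =
  local_form a e y (dchart e (param e y) (X (param e y))).
Proof.
by move=> ae ey; rewrite /local_form (coord_vectorK _ ae (param_source ey)).
Qed.

Lemma local_metric_field g e y (X : M -> 'rV[R]_n) (w : 'rV[R]_n) :
  atlas M e -> target e y ->
  g (param e y) (X (param e y)) (coord_vector e (param e y) w) =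
  local_metric g e y (dchart e (param e y) (X (param e y))) w.
Proof.
by move=> ae ey; rewrite /local_metric (coord_vectorK _ ae (param_source ey)).
Qed.

Lemma smooth_form_field a (X : M -> 'rV[R]_n) : smooth_field X ->
  smooth_fun (fun p => a p (X p)).
Proof.
move=> sX e ae; have oe := @open_target _ _ _ e.
apply: (@smooth_ext _ _ _ oe _ (fun y => \sum_j
  dchart e (param e y) (X (param e y)) 0 j * local_form a e y (u_ j))).
  by move=> y ey; rewrite /= local_form_field // -local_formE.
apply: (smooth_sum oe) => j _; apply: (smoothM oe); last exact: form_smooth.
exact: (smooth_coord oe j (sX e ae)).
Qed.

Lemma smooth_metric_field g (X : M -> 'rV[R]_n) e (w : 'rV[R]_n) :
  smooth_field X -> atlas M e ->
  smooth (target e) (fun y =>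
    g (param e y) (X (param e y)) (coord_vector e (param e y) w)).
Proof.
move=> sX ae; have oe := @open_target _ _ _ e.
apply: (@smooth_ext _ _ _ oe _ (fun y => \sum_j
  dchart e (param e y) (X (param e y)) 0 j * local_metric g e y (u_ j) w)).
  by move=> y ey; rewrite local_metric_field // -local_metricE.
apply: (smooth_sum oe) => j _; apply: (smoothM oe); last exact: metric_smooth.
exact: (smooth_coord oe j (sX e ae)).
Qed.

Lemma smooth_metric_field2 g (X : M -> 'rV[R]_n) : smooth_field X ->
  smooth_fun (fun p => g p (X p) (X p)).
Proof.
move=> sX e ae; have oe := @open_target _ _ _ e.
apply: (@smooth_ext _ _ _ oe _ (fun y => \sum_j
  dchart e (param e y) (X (param e y)) 0 j *
  g (param e y) (X (param e y)) (coord_vector e (param e y) (u_ j)))).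
  move=> y ey; set d := dchart e (param e y) (X (param e y)).
  have -> : ((fun p => g p (X p) (X p)) \o param e) y = local_metric g e y d d.
    by rewrite /local_metric (coord_vectorK _ ae (param_source ey)).
  rewrite (local_metricE g d d ae ey); apply: eq_bigr => j _.
  by rewrite (local_metric_field g X (u_ j) ae ey) local_metric_sym.
apply: (smooth_sum oe) => j _; apply: (smoothM oe); last exact: smooth_metric_field.
exact: (smooth_coord oe j (sX e ae)).
Qed.

End StrongGeodesicType.

(** * Construction of calibrating forms and metrics *)

Section Calibrations.
Context (R : realType) (n : nat) (M : smoothManifold R n).

Lemma metric_ge0 (g : riemannian_metric M) p (v : 'rV[R]_n) : 0 <= g p v v.
Proof.
have [->|v0] := eqVneq v 0; first by rewrite metric0l.
exact: ltW (metric_pos g p v0).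
Qed.

Lemma metric_combination (g : riemannian_metric M) p (b c : R) (u v : 'rV[R]_n) :
  g p (b *: u + c *: v) (b *: u + c *: v) =
  b ^+ 2 * g p u u + 2 * b * c * g p u v + c ^+ 2 * g p v v.
Proof.
have Zr d w z : g p w (d *: z) = d * g p w z.
  by rewrite Defs.metric_sym metricZl Defs.metric_sym.
rewrite metric_linear !metric_linearr !metricZl !Zr (Defs.metric_sym g p v u).
by ring.
Qed.

Lemma metric_CauchySchwarz (g : riemannian_metric M) p (u v : 'rV[R]_n) :
  g p u v ^+ 2 <= g p u u * g p v v.
Proof.
have [->|u0] := eqVneq u 0; first by rewrite !metric0l expr0n mul0r.
(* This vector is g(u, u) times the component of [v] orthogonal to [u]; its square norm is g(u, u)
   (g(u, u) g(v, v) - g(u, v)^2). *)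
have := metric_ge0 g p (- g p u v *: u + g p u u *: v).
rewrite metric_combination; have := metric_pos g p u0.
move: (g p u u) (g p u v) (g p v v) => A B D A0 H.
have : 0 <= A * (A * D - B ^+ 2) by move: H; congr (0 <= _); ring.
by rewrite pmulr_rge0 // subr_ge0.
Qed.

(* AM-GM: [2 C |X| / (C + |X|^2) <= sqrt C], with equality where [|X|^2 = C]. *)
Lemma calibrating_form (g : riemannian_metric M) (X : M -> 'rV[R]_n) C :
  0 < C -> smooth_field X ->
  exists a : one_form M, (forall p (v : 'rV[R]_n), a p v ^+ 2 <= C * g p v v) /\
    forall p, g p (X p) (X p) = C -> forall v : 'rV[R]_n, a p v = g p (X p) v.
Proof.
move=> C0 sX; pose N p := g p (X p) (X p).
have N0 p : 0 <= N p by exact: metric_ge0.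
have CN p : 0 < C + N p by rewrite ltr_wpDr.
pose f p := (2 * C) * (C + N p)^-1.
pose a p (v : tangent p) := f p * g p (X p) v.
have a_linear p (c : R) (v w : 'rV[R]_n) : a p (c *: v + w) = c * a p v + a p w.
  by rewrite /a metric_linearr mulrDr mulrCA.
have a_smooth e (ae : atlas M e) w : smooth (target e) (fun y => local_form a e y w).
  have oe := @open_target _ _ _ e.
  have s0 (c : R) : smooth (target e) (fun=> c) by exact: smooth_cst.
  have sN := smooth_metric_field2 g sX ae.
  have s1 := smoothV oe (fun y _ => lt0r_neq0 (CN (param e y))) (smoothD oe (s0 C) sN).
  exact: (smoothM oe (smoothM oe (s0 (2 * C)) s1) (smooth_metric_field g w sX ae)).
exists (OneForm a_linear a_smooth); split=> [p v|p pC v] /=; last first.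
  rewrite /a /f -[N p]/(g p (X p) (X p)) pC -mulr2n -[C *+ 2]mulr_natl.
  by rewrite mulfV ?mul1r // mulf_neq0 ?pnatr_eq0 // lt0r_neq0.
rewrite /a exprMn.
apply: (@le_trans _ _ (f p ^+ 2 * (N p * g p v v))).
  by rewrite ler_wpM2l ?sqr_ge0 //; exact: metric_CauchySchwarz.
rewrite mulrA ler_wpM2r ?metric_ge0 // /f.
move: (N p) (N0 p) (CN p) => b b0 Cb.
rewrite exprMn exprVn mulrAC ler_pdivrMr ?exprn_gt0 //.
rewrite -subr_ge0.
have -> : C * (C + b) ^+ 2 - (2 * C) ^+ 2 * b = C * (C - b) ^+ 2 by ring.
by rewrite mulr_ge0 ?sqr_ge0 // ltW.
Qed.

Lemma calibrating_metric (a : one_form M) (X : M -> 'rV[R]_n) c :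
  compact [set: M] -> 0 < c -> smooth_field X ->
  exists g : riemannian_metric M,
    (forall p (v : 'rV[R]_n), a p v ^+ 2 <= c * g p v v) /\
    forall p, a p (X p) = c -> forall v : 'rV[R]_n, g p (X p) v = a p v.
Proof.
move=> cM c0 sX; have [h] := exists_metric cM.
pose A p := a p (X p); pose N p := h p (X p) (X p).
pose H p (v : tangent p) := h p (X p) v.
(* [h (A v - a(v) X, A w - a(w) X) + a(v) a(w) / c + (c - A)^2 h (v, w)] *)
pose g p (v w : tangent p) :=
  A p * A p * h p v w - A p * (a p v * H p w + a p w * H p v)
  + N p * (a p v * a p w) + c^-1 * (a p v * a p w)
  + (c - A p) * (c - A p) * h p v w.
(* The expanded definition of [g] makes linearity, symmetry and smoothness immediate; on the
   diagonal it regroups into three nonnegative terms, from which positivity and the bound are read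
   off. *)
have gE p (v : 'rV[R]_n) : g p v v =
    h p (A p *: v + (- a p v) *: X p) (A p *: v + (- a p v) *: X p)
    + c^-1 * a p v ^+ 2 + (c - A p) ^+ 2 * h p v v.
  rewrite metric_combination /g /H -/(N p) (Defs.metric_sym h p (X p)).
  by ring.
have g_linear p (d : R) (u v w : 'rV[R]_n) : g p (d *: u + v) w = d * g p u w + g p v w.
  rewrite /g /H metric_linear metric_linearr form_linear.
  by ring.
have g_sym p (v w : 'rV[R]_n) : g p v w = g p w v.
  by rewrite /g (Defs.metric_sym h p v w); ring.
have g_pos p (v : 'rV[R]_n) : v != 0 -> 0 < g p v v.
  move=> v0; rewrite gE; have hv := metric_pos h p v0.
  have h1 := metric_ge0 h p (A p *: v + - a p v *: X p).
  have ci : 0 < c^-1 by rewrite invr_gt0.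
  have h2 : 0 <= c^-1 * a p v ^+ 2 by rewrite mulr_ge0 ?sqr_ge0 // ltW.
  have h3 : 0 <= (c - A p) ^+ 2 * h p v v by rewrite mulr_ge0 ?sqr_ge0 // ltW.
  (* One of the three terms is always positive: the last if A differs from [c], the middle one if
     α(v) is nonzero, and otherwise the first, since then P v = c v. *)
  have [Ac|Ac] := eqVneq (c - A p) 0; last first.
    apply: ltr_wpDl; first exact: addr_ge0.
    by rewrite mulr_gt0 // exprn_even_gt0.
  apply: ltr_pwDl => //.
  have [av|av] := eqVneq (a p v) 0; last first.
    by apply: ltr_wpDl => //; rewrite mulr_gt0 // exprn_even_gt0.
  apply: ltr_pwDl => //; rewrite av oppr0 scale0r addr0.
  have -> : A p = c by apply/eqP; rewrite eq_sym -subr_eq0 Ac.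
  by apply: metric_pos; rewrite scaler_eq0 (negbTE v0) orbF lt0r_neq0.
have g_smooth e (ae : atlas M e) v w :
    smooth (target e) (fun y => local_metric g e y v w).
  have oe := @open_target _ _ _ e.
  have s0 (d : R) : smooth (target e) (fun=> d) by exact: smooth_cst.
  have sA := smooth_form_field a sX ae.
  have sN := smooth_metric_field2 h sX ae.
  have sH u := smooth_metric_field h u sX ae.
  have sa u := form_smooth a ae u.
  have sh := metric_smooth h ae v w.
  have saa := smoothM oe (sa v) (sa w).
  have scA := smoothD oe (s0 c) (smoothN oe sA).
  have s1 := smoothM oe (smoothM oe sA sA) sh.
  have s2 := smoothN oe (smoothM oe sA (smoothD oe (smoothM oe (sa v) (sH w))
                                               (smoothM oe (sa w) (sH v)))).
  exact: (smoothD oe (smoothD oe (smoothD oe (smoothD oe s1 s2) (smoothM oe sN saa))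
    (smoothM oe (s0 c^-1) saa)) (smoothM oe (smoothM oe scA scA) sh)).
exists (RiemannianMetric g_linear g_sym g_pos g_smooth); split=> [p v|p pc v] /=.
  rewrite gE -[leLHS](mulVKf (lt0r_neq0 c0)) ler_wpM2l ?(ltW c0) //.
  have h1 := metric_ge0 h p (A p *: v + - a p v *: X p).
  have h3 : 0 <= (c - A p) ^+ 2 * h p v v by rewrite mulr_ge0 ?sqr_ge0 ?metric_ge0.
  by rewrite -addrA ler_wpDl // lerDl.
rewrite /g /H -[A p]/(a p (X p)) -[N p]/(h p (X p) (X p)) pc.
move: (h p (X p) v) (h p (X p) (X p)) (a p v) => B D E.
by field; exact: lt0r_neq0.
Qed.

End Calibrations.

(* In the second part the constant value of α(γ') has to be positive, since
   the conclusion forces it to equal g(γ', γ'). *)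
Theorem theorem3 (R : realType) (n : nat) (M : smoothManifold R n)
    (compactM : compact [set: M]) (connectedM : connected [set: M]) :
  (forall (g : riemannian_metric M) (T : R) (gamma : R -> M),
     embedded_loop T gamma -> geodesic g gamma ->
     null_homologous T gamma -> coorientable T gamma ->
     exists a : one_form M,
       strong_magnetic_geodesic g a T gamma /\ strong_geodesic_type g a) /\
  (forall (T : R) (gamma : R -> M) (a : one_form M),
     embedded_loop T gamma ->
     null_homologous T gamma -> coorientable T gamma ->
     (forall t, ker_dform a (velocity gamma t)) ->
     (exists2 c : R, 0 < c & forall t, a (gamma t) (velocity gamma t) = c) ->
     exists g : riemannian_metric M,
       strong_magnetic_geodesic g a T gamma /\ strong_geodesic_type g a).
Proof.
split=> [g T gamma emb geo nh co|T gamma a emb nh co ker [c c0 ac]].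
- have [X sX XE] := velocity_extension compactM emb.
  (* [C] is the squared speed at parameter 0, which a geodesic keeps for all time. *)
  have C0 := loop_pos g 0 emb; have speed t := geodesic_constant_speed t geo.
  have [a [aC aX]] := calibrating_form g C0 sX.
  suff smg : strong_magnetic_geodesic g a T gamma.
    by exists a; split; [exact: smg|exists T, gamma].
  apply: (calibrated_strong C0 emb co nh aC _ speed); last by left.
  by move=> t v; rewrite aX XE //; exact: speed.
- have [X sX XE] := velocity_extension compactM emb.
  have [g [aC gX]] := calibrating_metric a compactM c0 sX.
  have ga t (v : tangent (gamma t)) :
      g (gamma t) (velocity gamma t) v = a (gamma t) v.
    by rewrite -XE gX // XE; exact: ac.
  suff smg : strong_magnetic_geodesic g a T gamma.
    by exists g; split; [exact: smg|exists T, gamma].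
  apply: (calibrated_strong c0 emb co nh aC ga); last by right.
  by move=> t; rewrite ga.
Qed.
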